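(* Let $d,m\ge1$, $2\le p<3$, $\gamma\in(0,1]$ with $2+\gamma>p$. Let $f$ be a $\mathrm{Lip}(1+\gamma)$ vector field from $\mathbb{R}^d$ to $L(\mathbb{R}^m,\mathbb{R}^d)$ such that $f\cdot\nabla f$ is a $\mathrm{Lip}(\gamma)$ vector field from $\mathbb{R}^d$ to $L(\mathbb{R}^m\otimes\mathbb{R}^m,\mathbb{R}^d)$. Let $a\in\mathbb{R}^d$ and let $\mathbf{x}$ be a (not necessarily geometric) rough path with values in $T_2(\mathbb{R}^m)$, of finite $p$-variation controlled by a control $\omega$ on $[0,T]$. Then there exists a global solution (a solution on all of $[0,T]$, with no explosion) to $$\mathbf{y}_t=a+\int_0^t f(y_s)\,\mathrm{d}\mathbf{x}_s.$$
   Context: Lipschitz classes. For Banach spaces $A,B$ and $\gamma\in(0,1]$, a $\mathrm{Lip}(\gamma)$ map $A\to B$ is a $\gamma$-Hölder continuous map. A $\mathrm{Lip}(1+\gamma)$ map $f:A\to B$ is a Lipschitz map for which there is a bounded $\gamma$-Hölder map $\nabla f:A\to L(A,B)$ with $|f(u)-f(u')-\nabla f(u')(u-u')|\le C|u-u'|^{1+\gamma}$ for all $u,u'$. Such maps need not be bounded. Notation. $(f\cdot\nabla f)(v)(u\otimes w)=\nabla f(v)(f(v)u)\,w$ for $v\in\mathbb{R}^d$, $u,w\in\mathbb{R}^m$. Rough paths. $T_2(U)=\mathbb{R}\oplus U\oplus(U\otimes U)$ is the truncated tensor algebra, with compatible norms; $\pi_U,\pi_{U\otimes U}$ are the projections.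 A control is a continuous function $\omega(s,t)\ge0$ on $0\le s\le t\le T$, super-additive and vanishing on the diagonal. A rough path of finite $p$-variation controlled by $\omega$ is a path $\mathbf{x}:[0,T]\to\{1\}\oplus U\oplus(U\otimes U)$ such that $\mathbf{x}_{s,t}=\mathbf{x}_s^{-1}\otimes\mathbf{x}_t$ satisfies $|\pi_U(\mathbf{x}_{s,t})|\le C\omega(s,t)^{1/p}$ and $|\pi_{U\otimes U}(\mathbf{x}_{s,t})|\le C\omega(s,t)^{2/p}$. Solutions. A solution (with $U=\mathbb{R}^m$, $V=\mathbb{R}^d$) of $\mathbf{y}_t=a+\int_0^tf(y_s)\,\mathrm{d}\mathbf{x}_s$ is a rough path $\mathbf{y}$ of finite $p$-variation controlled by $\omega$ with values in $T_2(U\oplus V)$, extending $\mathbf{x}$ (its projection on $T_2(U)$ is $\mathbf{x}$), whose $V$-component $y$ starts from $y_0=a$, such that for some $\theta>1$, up to errors bounded by $C\omega(s,t)^\theta$: the $V$-component of $\mathbf{y}_{s,t}$ is $f(y_s)\pi_U(\mathbf{x}_{s,t})+(f\cdot\nabla f)(y_s)\pi_{U\otimes U}(\mathbf{x}_{s,t})$, and its $V\otimes V$, $V\otimes U$, $U\otimes V$ components are respectively $(f(y_s)\otimes f(y_s))$, $(f(y_s)\otimes 1)$, $(1\otimes f(y_s))$ applied to $\pi_{U\otimes U}(\mathbf{x}_{s,t})$. *)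

(* Defs.v *)
From HB Require Import structures.
From mathcomp Require Import all_boot all_order all_algebra.
From mathcomp Require Import all_classical all_reals all_analysis.
Import Order.TTheory GRing.Theory Num.Theory.
Import numFieldNormedType.Exports.

Set Implicit Arguments.
Unset Strict Implicit.
Unset Printing Implicit Defensive.

Local Open Scope classical_set_scope.
Local Open Scope ring_scope.

(* R^n is 'cV[R]_n, L(R^m, R^d) is 'M[R]_(d, m), and R^m (x) R^n is
   'M[R]_(m, n) with u (x) w = u *m w^T.  All carry the library's max norm
   (for which |u (x) w| = |u| |w|); every estimate below holds up to a
   constant, so any other choice of norms gives the same notions. *)

Definition tensor (R : realType) (m n : nat) (u : 'cV[R]_m) (w : 'cV[R]_n) :
  'M[R]_(m, n) := u *m w^T.

(* Maps into L(E, F) with the operator norm, where |L| <= c is spelled out as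
   |L h| <= c |h| for all h; used for finite dimensional E and F, where all
   linear maps are bounded. *)
Definition op_holder (R : realType) (A E F : normedModType R) (gamma : R)
    (g : A -> {linear E -> F}) : Prop :=
  exists C : R, forall (u u' : A) (h : E),
    `|g u h - g u' h| <= C * `|u - u'| `^ gamma * `|h|.

Definition op_bounded (R : realType) (A E F : normedModType R)
    (g : A -> {linear E -> F}) : Prop :=
  exists C : R, forall (u : A) (h : E), `|g u h| <= C * `|h|.

(* f is Lip(1 + gamma) with gradient Df.  The Taylor estimate determines Df
   from f. *)
Definition lip1 (R : realType) (A B : normedModType R) (gamma : R)
    (f : A -> B) (Df : A -> {linear A -> B}) : Prop :=
  [/\ exists k : R, k.-lipschitz f,
      op_bounded Df,
      op_holder gamma Df
    & exists C : R, forall u u' : A,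
        `|f u - f u' - Df u' (u - u')| <= C * `|u - u'| `^ (1 + gamma)].

(* f . Df, as the linear map on R^m (x) R^m extending
   u (x) w |-> Df v (f v u) w; see f_nabla_f_tensor. *)
Definition f_nabla_f (R : realType) (d m : nat) (f : 'cV[R]_d -> 'M[R]_(d, m))
    (Df : 'cV[R]_d -> {linear 'cV[R]_d -> 'M[R]_(d, m)})
    (v : 'cV[R]_d) (X : 'M[R]_m) : 'cV[R]_d :=
  \sum_(i < m) \sum_(j < m) X i j *: col j (Df v (col i (f v))).

Fact f_nabla_f_is_linear (R : realType) (d m : nat)
    (f : 'cV[R]_d -> 'M[R]_(d, m))
    (Df : 'cV[R]_d -> {linear 'cV[R]_d -> 'M[R]_(d, m)}) (v : 'cV[R]_d) :
  linear (f_nabla_f f Df v).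
Proof.
move=> a X Y; rewrite /f_nabla_f scaler_sumr -big_split /=.
apply: eq_bigr => i _; rewrite scaler_sumr -big_split /=.
by apply: eq_bigr => j _; rewrite !mxE scalerDl scalerA.
Qed.

HB.instance Definition _ (R : realType) (d m : nat)
    (f : 'cV[R]_d -> 'M[R]_(d, m))
    (Df : 'cV[R]_d -> {linear 'cV[R]_d -> 'M[R]_(d, m)}) (v : 'cV[R]_d) :=
  GRing.isLinear.Build R 'M[R]_m 'cV[R]_d _ (f_nabla_f f Df v)
    (f_nabla_f_is_linear f Df v).

Lemma mulmx_col_sum (R : realType) (d m : nat) (A : 'M[R]_(d, m))
    (u : 'cV[R]_m) : A *m u = \sum_(i < m) u i 0 *: col i A.
Proof.
apply/colP => k; rewrite !mxE summxE.
by apply: eq_bigr => i _; rewrite !mxE mulrC.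
Qed.

Lemma f_nabla_f_tensor (R : realType) (d m : nat)
    (f : 'cV[R]_d -> 'M[R]_(d, m))
    (Df : 'cV[R]_d -> {linear 'cV[R]_d -> 'M[R]_(d, m)})
    (v : 'cV[R]_d) (u w : 'cV[R]_m) :
  f_nabla_f f Df v (tensor u w) = Df v (f v *m u) *m w.
Proof.
rewrite (mulmx_col_sum (f v)) linear_sum mulmx_suml /=.
apply: eq_bigr => i _; rewrite linearZ -scalemxAl mulmx_col_sum scaler_sumr.
by apply: eq_bigr => j _; rewrite scalerA !mxE big_ord1 !mxE.
Qed.

(* T_2(R^n) = R (+) R^n (+) (R^n (x) R^n). *)
Record T2 (R : realType) (n : nat) := MkT2 {
  lev0 : R;
  lev1 : 'cV[R]_n;
  lev2 : 'M[R]_n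
}.

Definition T2one (R : realType) (n : nat) : T2 R n := MkT2 1 0 0.

Definition T2mul (R : realType) (n : nat) (a b : T2 R n) : T2 R n :=
  MkT2 (lev0 a * lev0 b)
       (lev0 a *: lev1 b + lev0 b *: lev1 a)
       (lev0 a *: lev2 b + lev0 b *: lev2 a + tensor (lev1 a) (lev1 b)).

(* Meaningful when lev0 a != 0; see T2mulV and T2mulVl. *)
Definition T2inv (R : realType) (n : nat) (a : T2 R n) : T2 R n :=
  MkT2 (lev0 a)^-1
       (- (lev0 a ^- 2 *: lev1 a))
       (lev0 a ^- 3 *: tensor (lev1 a) (lev1 a) - lev0 a ^- 2 *: lev2 a).

Lemma T2mulV (R : realType) (n : nat) (a : T2 R n) :
  lev0 a != 0 -> T2mul a (T2inv a) = T2one R n.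
Proof.
case: a => r u X /= r0; rewrite /T2mul /T2inv /T2one /tensor /=.
have e1 : r * r ^- 2 = r^-1 by rewrite expr2 invfM mulVKf.
have e2 : r * r ^- 3 = r ^- 2 by rewrite exprS invfM mulVKf.
congr MkT2; first by rewrite divff.
  by rewrite scalerN scalerA e1 addNr.
rewrite scalerBr !scalerA e1 e2 subrK linearN linearZ /=.
by rewrite mulmxN -scalemxAr subrr.
Qed.

Lemma T2mulVl (R : realType) (n : nat) (a : T2 R n) :
  lev0 a != 0 -> T2mul (T2inv a) a = T2one R n.
Proof.
case: a => r u X /= r0; rewrite /T2mul /T2inv /T2one /tensor /=.
have e1 : r * r ^- 2 = r^-1 by rewrite expr2 invfM mulVKf.
have e2 : r * r ^- 3 = r ^- 2 by rewrite exprS invfM mulVKf.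
congr MkT2; first by rewrite mulVf.
  by rewrite scalerN scalerA e1 subrr.
rewrite scalerBr !scalerA e1 e2 mulNmx -scalemxAl.
by rewrite (addrC (_ *: X)) subrK subrr.
Qed.

Definition T2incr (R : realType) (n : nat) (x : R -> T2 R n) (s t : R) :
  T2 R n := T2mul (T2inv (x s)) (x t).

Definition control (R : realType) (T : R) (omega : R -> R -> R) : Prop :=
  [/\ {within [set z : R * R | [/\ 0 <= z.1, z.1 <= z.2 & z.2 <= T]],
        continuous (fun z : R * R => omega z.1 z.2)},
      forall s t, 0 <= s -> s <= t -> t <= T -> 0 <= omega s t,
      forall s r t, 0 <= s -> s <= r -> r <= t -> t <= T ->
        omega s r + omega r t <= omega s t
    & forall t, 0 <= t -> t <= T -> omega t t = 0].

(* Paths on [0, T] are functions on R of which only the values on [0, T]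
   matter. *)
Definition rough_path (R : realType) (n : nat) (p T : R)
    (omega : R -> R -> R) (x : R -> T2 R n) : Prop :=
  (forall t, 0 <= t -> t <= T -> lev0 (x t) = 1) /\
  exists C : R, forall s t, 0 <= s -> s <= t -> t <= T ->
    `|lev1 (T2incr x s t)| <= C * omega s t `^ (1 / p) /\
    `|lev2 (T2incr x s t)| <= C * omega s t `^ (2 / p).

(* With U = R^m and V = R^d, U (+) V is 'cV_(m + d), the U-component first,
   and the U (x) U, U (x) V, V (x) U and V (x) V components of a tensor are
   its upper left, upper right, lower left and lower right blocks. *)
Definition T2projU (R : realType) (m d : nat) (z : T2 R (m + d)) : T2 R m :=
  MkT2 (lev0 z) (usubmx (lev1 z)) (ulsubmx (lev2 z)).

(* For B : 'M_(d, m) and X in U (x) U, (B (x) B) X = B *m X *m B^T,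
   (B (x) 1) X = B *m X and (1 (x) B) X = X *m B^T. *)
Definition rde_solution (R : realType) (d m : nat) (p T : R)
    (omega : R -> R -> R) (f : 'cV[R]_d -> 'M[R]_(d, m))
    (Df : 'cV[R]_d -> {linear 'cV[R]_d -> 'M[R]_(d, m)})
    (a : 'cV[R]_d) (x : R -> T2 R m) (y : R -> T2 R (m + d)) : Prop :=
  [/\ rough_path p T omega y,
      forall t, 0 <= t -> t <= T -> T2projU (y t) = x t,
      dsubmx (lev1 (y 0)) = a
    & exists theta C : R, 1 < theta /\
      forall s t, 0 <= s -> s <= t -> t <= T ->
        let ys := dsubmx (lev1 (y s)) in
        let X := T2incr x s t in
        let Y := T2incr y s t in
        let err := C * omega s t `^ theta in
        [/\ `|dsubmx (lev1 Y)
              - (f ys *m lev1 X + f_nabla_f f Df ys (lev2 X))| <= err,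
            `|drsubmx (lev2 Y) - f ys *m lev2 X *m (f ys)^T| <= err,
            `|dlsubmx (lev2 Y) - f ys *m lev2 X| <= err
          & `|ursubmx (lev2 Y) - lev2 X *m (f ys)^T| <= err]].

(* Main.v *)
Require Import Defs.
From HB Require Import structures.
From mathcomp Require Import all_boot all_order all_algebra.
From mathcomp Require Import all_classical all_reals all_analysis.
From mathcomp Require Import ring lra zify.
Import Order.TTheory GRing.Theory Num.Theory.
Import numFieldNormedType.Exports.

Set Implicit Arguments.
Unset Strict Implicit.
Unset Printing Implicit Defensive.

Local Open Scope classical_set_scope.
Local Open Scope ring_scope.

(** Write mu_(s,t)(y) = y + f(y) X1 + (f.Df)(y) X2 for the second order Euler
    step over [s, t], where X1, X2 are the levels of the increment of x.  A
    solution is a path along which y_t - mu_(s,t)(y_s) is O(omega^theta) with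
    theta = (2 + gamma) / p > 1, together with iterated integrals of (x, y).

    Explosion is excluded by a bound on the defect
    mu_(r,t)(mu_(s,r)(y)) - mu_(s,t)(y).  The Taylor estimate alone bounds it
    by a multiple of (1 + |y|)^(1 + gamma) omega^theta, whose growth in y is
    too fast.  The Hoelder continuity of f.Df improves this to
    (1 + |y|) omega^theta (euler_defect): along the segment
    y_tau = y + tau f(y) u,
      (Df(y_tau) - Df(y)) (f(y) u) w
        = ((f.Df)(y_tau) - (f.Df)(y)) (u (x) w)
          + Df(y_tau) ((f(y) - f(y_tau)) u) w,
    and the two terms grow like |y|^gamma and |y|.

    The maps mu then form what is called here an almost flow.  Run the scheme
    y_(i+1) = mu(y_i) on a finite grid.  Splitting an interval into two parts
    that carry at most half of omega each, and the single grid step between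
    them, gives by induction the bound K omega^theta for y_j - mu(y_i), because
    2 (1/2)^theta < 1 (scheme_local); as all growth is linear, the constants
    depend neither on the grid nor on the size of y, and concatenation over
    finitely many pieces of small omega gives bounds on [0, T]
    (scheme_global).  For a given pair (s, t) the bound on
    y_t - mu_(s,t)(y_s) is a closed condition on y for pointwise convergence;
    finitely many such conditions are met by the scheme on the grid of the
    times involved, and paths in a ball form a compact set, so all of them can
    be met at once (almost_flow_solution).

    The same theorem produces the second level: for z = (x, y) the translations
    Z |-> Z + z_s (x) (z_t - z_s) + F(y_s) X2 F(y_s)^T, with F = (1, f), form an
    almost flow, by Chen's relation (level2_lift).  Its solution is the second
    level of the lift once the U (x) U block is replaced by that of x, which
    changes nothing else in the estimates (residual_norm_le). *)

(** * Real powers *)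

Lemma ler_powRl (R : realType) (r a b : R) :
  0 <= r -> 0 <= a -> a <= b -> a `^ r <= b `^ r.
Proof. by move=> r0 a0 ab; apply: ge0_ler_powR; rewrite ?nnegrE// (le_trans a0). Qed.

Lemma powR_le_root (R : realType) (r W delta : R) :
  0 < r -> 0 <= W -> 0 <= delta -> W <= delta `^ r^-1 -> W `^ r <= delta.
Proof.
move=> r0 W0 d0 /(ler_powRl (ltW r0) W0); rewrite -powRrM mulVf ?gt_eqF//.
by rewrite powRr1.
Qed.

Lemma powR_split (R : realType) (a b Omega W : R) :
  0 <= a -> 0 < b -> 0 <= W -> W <= Omega ->
  W `^ (a + b) <= Omega `^ a * W `^ b.
Proof.
move=> a0 b0 W0 WO; rewrite powRD; last by rewrite gt_eqF// ltr_wpDl.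
by rewrite ler_wpM2r ?powR_ge0// ler_powRl.
Qed.

(** * Almost flows *)

(** The conditions are those of an Euler step driven by a rough path, with
    [kappa] standing for 1/p.  The first two grow at most linearly in [y],
    which is what excludes explosion.  In the third, the factor of the Lipschitz
    term is the size of the first level, which multiplies a Lipschitz field, and
    the other factor is that of the second level, which multiplies a Hoelder
    field. *)
Definition almost_flow (R : realType) (E : normedModType R) (T kappa gamma C : R)
    (omega : R -> R -> R) (mu : R -> R -> E -> E) : Prop :=
  [/\ forall (s t : R) (y : E), 0 <= s -> s <= t -> t <= T ->
        `|mu s t y - y| <= C * (1 + `|y|) * omega s t `^ kappa,
      forall (s r t : R) (y : E), 0 <= s -> s <= r -> r <= t -> t <= T ->
        `|mu r t (mu s r y) - mu s t y|
          <= C * (1 + `|y|) * omega s t `^ ((2 + gamma) * kappa)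
    & forall (s t : R) (y y' : E), 0 <= s -> s <= t -> t <= T ->
        `|mu s t y - mu s t y'| <= `|y - y'| +
          C * (omega s t `^ kappa * `|y - y'|
               + omega s t `^ (2 * kappa) * `|y - y'| `^ gamma)].

Definition superadditive (R : realType) (T : R) (omega : R -> R -> R) : Prop :=
  [/\ forall s t : R, 0 <= s -> s <= t -> t <= T -> 0 <= omega s t,
      forall s r t : R, 0 <= s -> s <= r -> r <= t -> t <= T ->
        omega s r + omega r t <= omega s t
    & forall t : R, 0 <= t -> t <= T -> omega t t = 0].

Lemma superadditive_le (R : realType) (T : R) (omega : R -> R -> R) (s r r' t : R) :
  superadditive T omega -> 0 <= s -> s <= r -> r <= r' -> r' <= t -> t <= T ->
  omega r r' <= omega s t.
Proof.
move=> [w0 wD _] s0 sr rr rt tT.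
have a1 := wD s r t s0 sr (le_trans rr rt) tT.
have a2 := wD r r' t (le_trans s0 sr) rr rt tT.
have b1 := w0 s r s0 sr (le_trans rr (le_trans rt tT)).
have b2 := w0 r' t (le_trans s0 (le_trans sr rr)) rt tT.
lra.
Qed.

(** The form in which the conditions are used.  Let [W] be the size of an
    interval; the errors to be propagated are at most B W^theta with
    theta = (2 + gamma) kappa, and on that scale even the Hoelder term of the
    third condition is smaller than B W^theta by a factor W^(gamma kappa), since
    2 kappa + gamma theta = theta + gamma kappa + gamma^2 kappa.  For [B >= 1],
    B^gamma <= B keeps the bound linear in [B]. *)
Lemma almost_flow_gauge (R : realType) (E : normedModType R)
    (T kappa gamma C : R) (omega : R -> R -> R) (mu : R -> R -> E -> E) :
  0 < kappa -> 0 < gamma -> gamma <= 1 -> 0 <= C -> superadditive T omega ->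
  almost_flow T kappa gamma C omega mu ->
  exists2 C1 : R, C <= C1 & forall s t W : R, 0 <= s -> s <= t -> t <= T ->
    omega s t <= W -> W <= omega 0 T ->
    (forall y, `|mu s t y - y| <= C1 * (1 + `|y|) * W `^ (gamma * kappa)) /\
    forall B y y', 1 <= B -> `|y - y'| <= B * W `^ ((2 + gamma) * kappa) ->
    `|mu s t y - mu s t y'|
      <= `|y - y'| + C1 * B * W `^ ((2 + gamma) * kappa) * W `^ (gamma * kappa).
Proof.
move=> k0 g0 g1 C0 sw [A1 A2 A3].
set Om := omega 0 T; set rho := gamma * kappa; set th := _ * kappa.
have rho0 : 0 < rho by rewrite mulr_gt0.
have th0 : 0 < th by rewrite mulr_gt0// ltr_wpDr// ltW.
set c1 := Om `^ ((1 - gamma) * kappa); set c2 := Om `^ (gamma * gamma * kappa).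
have c10 : 0 <= c1 by exact: powR_ge0.
have c20 : 0 <= c2 by exact: powR_ge0.
exists (C * (1 + c1 + c2)); first by rewrite ler_peMr//; lra.
move=> s t W s0 st tT wW WO.
have w0 : 0 <= omega s t by case: sw => + _ _; exact.
have W0 := le_trans w0 wW.
have Wk : omega s t `^ kappa <= c1 * W `^ rho.
  apply: (le_trans (ler_powRl (ltW k0) w0 wW)).
  have -> : kappa = (1 - gamma) * kappa + rho by rewrite /rho; ring.
  by apply: powR_split => //; rewrite mulr_ge0 ?subr_ge0 ?(ltW k0).
have r0 : 0 <= W `^ rho by exact: powR_ge0.
split=> [y|B y y' B1 yy].
  apply: (le_trans (A1 s t y s0 st tT)).
  have y1 : 0 <= C * (1 + `|y|) by rewrite mulr_ge0// addr_ge0.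
  apply: (le_trans (ler_wpM2l y1 Wk)).
  have -> : C * (1 + c1 + c2) * (1 + `|y|) * W `^ rho =
    C * (1 + `|y|) * ((1 + c1 + c2) * W `^ rho) by ring.
  apply: (ler_wpM2l y1); apply: ler_wpM2r => //; lra.
apply: (le_trans (A3 s t y y' s0 st tT)).
rewrite lerD2l -!mulrA ler_wpM2l//.
set Wt := W `^ th.
have Wt0 : 0 <= Wt by exact: powR_ge0.
have B0 : 0 <= B by lra.
have e1 : omega s t `^ kappa * `|y - y'| <= c1 * W `^ rho * (B * Wt).
  by apply: ler_pM => //; exact: powR_ge0.
have e2 : omega s t `^ (2 * kappa) * `|y - y'| `^ gamma <= c2 * W `^ rho * (B * Wt).
  have h1 : `|y - y'| `^ gamma <= B * Wt `^ gamma.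
    apply: (le_trans (ler_powRl (ltW g0) _ yy)) => //.
    by rewrite powRM// ler_wpM2r ?powR_ge0// ler1_powR.
  have h2 : omega s t `^ (2 * kappa) <= W `^ (2 * kappa).
    by apply: ler_powRl => //; rewrite mulr_ge0// ltW.
  apply: (le_trans (ler_pM _ _ h2 h1)); rewrite ?powR_ge0//.
  have -> : W `^ (2 * kappa) * (B * Wt `^ gamma) = B * W `^ (2 * kappa + th * gamma).
    rewrite powRD; last by rewrite gt_eqF// addr_gt0// mulr_gt0.
    by rewrite (powRrM _ th) -/Wt; ring.
  have -> : 2 * kappa + th * gamma = gamma * gamma * kappa + (rho + th).
    by rewrite /th /rho; ring.
  have -> : c2 * W `^ rho * (B * Wt) = B * (c2 * (W `^ (rho + th))).
    rewrite powRD; last by rewrite gt_eqF// addr_gt0.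
    by rewrite -/Wt; ring.
  apply: ler_wpM2l => //; apply: powR_split => //; last by rewrite addr_gt0.
  by rewrite !mulr_ge0// ltW.
have e3 : 0 <= W `^ rho * (B * Wt) by rewrite !mulr_ge0.
rewrite -/Wt; lra.
Qed.

(** * The discrete scheme *)

Lemma nat_split (P : pred nat) (i j : nat) :
  (i < j)%N -> P i -> exists k : nat, [/\ (i <= k)%N, (k < j)%N, P k &
    (k.+1 < j)%N -> ~~ P k.+1].
Proof.
move=> ij Pi.
have ex : exists k, [&& (i <= k)%N, (k < j)%N & P k] by exists i; rewrite leqnn ij.
have ub k : [&& (i <= k)%N, (k < j)%N & P k] -> (k <= j)%N.
  by case/and3P => _ /ltnW.
case: (ex_maxnP ex ub) => k /and3P[ik kj Pk] kmax.
exists k; split => // kj1; apply/negP => Pk1.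
by have := kmax k.+1; rewrite (leqW ik) kj1 Pk1 ltnn => /(_ isT).
Qed.

Definition times (R : realType) (T : R) (tau : nat -> R) : Prop :=
  (forall i, 0 <= tau i /\ tau i <= T) /\
  (forall i j, (i <= j)%N -> tau i <= tau j).

Definition scheme (R : realType) (E : normedModType R) (mu : R -> R -> E -> E)
    (tau : nat -> R) (y : nat -> E) : Prop :=
  forall i, y i.+1 = mu (tau i) (tau i.+1) (y i).

(** The constants of scheme_local.  [a] is (1/2)^theta, [X] bounds the
    powers W^(gamma kappa) and W^theta.  The first two conclusions close the
    induction for the interval up to the middle grid step and for the whole
    interval; they hold because [K] is large with respect to [C], then [X] is
    small with respect to [K]. *)
Lemma splitting_arith (R : realType) (a C K X delta : R) :
  0 <= a -> 2 * a < 1 -> 0 <= C -> K = 1 + 4 * C / (1 - 2 * a) ->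
  0 <= X -> X <= delta -> delta = (1 - 2 * a) / (2 * (1 + K + 3 * C)) ->
  [/\ K * a + C * K * X + C <= K,
      a * K * (1 + K * X + C * X) + (K * a + C * K * X + C) + C * K * X + C <= K
    & K * X + C * X <= 1].
Proof.
move=> a0 a1 C0 KE X0 Xd dE.
have e0 : 0 < 1 - 2 * a by lra.
have q0 : 0 <= C / (1 - 2 * a) by rewrite divr_ge0// ltW.
have K1 : 1 <= K by rewrite KE -mulrA; lra.
have KC : 4 * C <= K * (1 - 2 * a).
  have -> : K * (1 - 2 * a) = 1 - 2 * a + 4 * C.
    by rewrite KE; field; rewrite gt_eqF.
  lra.
have dK : (1 + K + 3 * C) * delta = (1 - 2 * a) / 2.
  rewrite dE; field; rewrite gt_eqF//=; lra.
have XK : (1 + K + 3 * C) * X <= (1 - 2 * a) / 2.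
  by rewrite -dK ler_wpM2l//; lra.
have h1 : (K + 3 * C) * X <= (1 - 2 * a) / 2.
  rewrite !mulrDl mul1r in XK *; lra.
have CX : 0 <= C * X by rewrite mulr_ge0.
have KX : 0 <= K * X by rewrite mulr_ge0//; lra.
have h2 : K * ((K + 3 * C) * X) <= K * ((1 - 2 * a) / 2).
  by apply: ler_wpM2l => //; lra.
have KKX : 0 <= K * (K * X) by rewrite mulr_ge0//; lra.
have KCX : 0 <= K * (C * X) by rewrite mulr_ge0//; lra.
have aK : a * (K * (K * X + C * X)) <= 1 * (K * (K * X + C * X)).
  apply: ler_wpM2r; last by lra.
  by rewrite mulr_ge0 ?addr_ge0//; lra.
split.
- have -> : C * K * X = K * (C * X) by ring.
  have : K * (3 * (C * X)) <= K * ((1 - 2 * a) / 2).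
    by apply: ler_wpM2l; lra.
  lra.
- have -> : a * K * (1 + K * X + C * X) = a * K + a * (K * (K * X + C * X)) by ring.
  have -> : C * K * X = K * (C * X) by ring.
  rewrite mulrA in h2.
  have : K * (K * X) + 3 * (K * (C * X)) <= K * (1 - 2 * a) / 2.
    by rewrite -[leRHS]mulrA; apply: le_trans h2; rewrite le_eqVlt;
      apply/orP; left; apply/eqP; ring.
  lra.
- lra.
Qed.

Lemma ler_distD3 (R : realType) (E : normedModType R) (a b c d : E) :
  `|a - d| <= `|a - b| + `|b - c| + `|c - d|.
Proof. by apply: (le_trans (ler_distD c _ _)); rewrite lerD2r ler_distD. Qed.

Lemma subn_split (n i j k : nat) : (j - i <= n.+1)%N -> (i <= k)%N -> (k < j)%N ->
  (k - i <= n)%N /\ (j - k.+1 <= n)%N.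
Proof. lia. Qed.

(** This is where theta > 1 enters: halving omega gains more than the factor 2
    lost by adding the errors of two halves. *)
Lemma half_powR_lt (R : realType) (theta : R) :
  1 < theta -> 2 * (2^-1 : R) `^ theta < 1.
Proof.
move=> th1.
have -> : (2^-1 : R) `^ theta = 2^-1 * 2^-1 `^ (theta - 1).
  by rewrite mulr_powRB1 ?invr_ge0//; lra.
rewrite mulrA divff// mul1r.
have := @gt0_ltr_powR R (theta - 1) _ 2^-1 1.
rewrite powR1 !nnegrE; apply; rewrite ?invr_ge0//; first by lra.
by rewrite invf_lt1// ltr1n.
Qed.

(** The error is relative to [1 + |y i|], the size of the solution at the
    beginning of the interval, so that [omega0] depends on the constants
    of the almost flow only. *)
Lemma scheme_local (R : realType) (E : normedModType R)
    (T kappa gamma C : R) (omega : R -> R -> R) (mu : R -> R -> E -> E) :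
  0 < kappa -> 0 < gamma -> gamma <= 1 -> 1 < (2 + gamma) * kappa ->
  0 <= C -> superadditive T omega -> almost_flow T kappa gamma C omega mu ->
  exists K omega0 : R, [/\ 0 <= K, 0 < omega0 & forall tau y,
    times T tau -> scheme mu tau y -> forall i j, (i <= j)%N ->
    omega (tau i) (tau j) <= omega0 ->
    `|y j - mu (tau i) (tau j) (y i)|
      <= K * (1 + `|y i|) * omega (tau i) (tau j) `^ ((2 + gamma) * kappa)
    /\ 1 + `|y j| <= 2 * (1 + `|y i|)].
Proof.
move=> k0 g0 g1 th1 C00 sw af.
have [C1 CC1 gauge] := almost_flow_gauge k0 g0 g1 C00 sw af.
have [A1 A2 A3] := af.
have C0 : 0 <= C1 by exact: le_trans CC1.
set th := (2 + gamma) * kappa in th1 gauge *.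
set rho := gamma * kappa in gauge *.
have rho0 : 0 < rho by rewrite mulr_gt0.
have th0 : 0 < th by lra.
have := half_powR_lt th1; set a := 2^-1 `^ th => a1.
have a0 : 0 <= a by exact: powR_ge0.
have ale1 : a <= 1 by lra.
pose K := 1 + 4 * C1 / (1 - 2 * a).
have K1 : 1 <= K.
  have : 0 <= C1 / (1 - 2 * a) by rewrite divr_ge0//; lra.
  by rewrite /K -mulrA; lra.
have K0 : 0 <= K by lra.
pose delta := (1 - 2 * a) / (2 * (1 + K + 3 * C1)).
have d0 : 0 < delta by rewrite divr_gt0 ?mulr_gt0//; lra.
pose om0 := Num.min (delta `^ rho^-1) (delta `^ th^-1).
(* om0 is small enough for both W^rho and W^th to be at most delta. *)
exists K, om0; split; [by lra | by rewrite lt_min !powR_gt0 |].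
move=> tau y [tauT taui] ys.
have w0 i j : (i <= j)%N -> 0 <= omega (tau i) (tau j).
  move=> ij; case: sw => + _ _; apply; [exact: (tauT i).1|exact: taui|exact: (tauT j).2].
have wle i k l j : (i <= k)%N -> (k <= l)%N -> (l <= j)%N ->
    omega (tau k) (tau l) <= omega (tau i) (tau j).
  move=> ik kl lj; apply: (superadditive_le sw); rewrite ?taui//;
    [exact: (tauT i).1|exact: (tauT j).2].
have wadd i k j : (i <= k)%N -> (k <= j)%N ->
    omega (tau i) (tau k) + omega (tau k) (tau j) <= omega (tau i) (tau j).
  move=> ik kj; case: sw => _ + _; apply; rewrite ?taui//;
    [exact: (tauT i).1|exact: (tauT j).2].
have wOm i j : (i <= j)%N -> omega (tau i) (tau j) <= omega 0 T.
  move=> ij; apply: (superadditive_le sw); rewrite ?taui//;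
    [exact: (tauT i).1|exact: (tauT j).2].
have small i j : (i <= j)%N -> omega (tau i) (tau j) <= om0 ->
  exists X, [/\ 0 <= X, X <= delta, omega (tau i) (tau j) `^ rho <= X
              & omega (tau i) (tau j) `^ th <= X].
  move=> ij; rewrite le_min => /andP[h1 h2].
  exists delta; split => //; first exact: ltW.
    by apply: powR_le_root => //; [exact: w0|exact: ltW].
  by apply: powR_le_root => //; [exact: w0|exact: ltW].
have growth i j k : (i <= k)%N -> (k <= j)%N -> omega (tau i) (tau j) <= om0 ->
    `|y k - mu (tau i) (tau k) (y i)|
      <= K * (1 + `|y i|) * omega (tau i) (tau j) `^ th ->
    forall X, omega (tau i) (tau j) `^ rho <= X -> omega (tau i) (tau j) `^ th <= X ->
    1 + `|y k| <= (1 + `|y i|) * (1 + K * X + C1 * X).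
  move=> ik kj wom Dk X X1 X2.
  have [/(_ (y i)) g1' _] := gauge (tau i) (tau k) _ (tauT i).1 (taui _ _ ik)
     (tauT k).2 (wle _ _ _ _ (leqnn i) ik kj) (wOm _ _ (leq_trans ik kj)).
  have M0 : 0 <= 1 + `|y i| by rewrite addr_ge0.
  have h : `|y k| <= `|y i| + `|mu (tau i) (tau k) (y i) - y i|
                    + `|y k - mu (tau i) (tau k) (y i)|.
    have := ler_distD3 (y k) (mu (tau i) (tau k) (y i)) (y i) 0.
    by rewrite !subr0; lra.
  have e1 : K * (1 + `|y i|) * omega (tau i) (tau j) `^ th <= K * (1 + `|y i|) * X.
    by apply: ler_wpM2l => //; rewrite mulr_ge0//; lra.
  have e2 : C1 * (1 + `|y i|) * omega (tau i) (tau j) `^ rho <= C1 * (1 + `|y i|) * X.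
    by apply: ler_wpM2l => //; rewrite mulr_ge0.
  have -> : (1 + `|y i|) * (1 + K * X + C1 * X) =
    1 + `|y i| + K * (1 + `|y i|) * X + C1 * (1 + `|y i|) * X by ring.
  lra.
(* The first condition with omega t t = 0. *)
have muid i z : mu (tau i) (tau i) z = z.
  apply/eqP; rewrite -subr_eq0 -normr_le0.
  have := A1 _ _ z (tauT i).1 (lexx _) (tauT i).2.
  case: sw => _ _ -> //; [|exact: (tauT i).1|exact: (tauT i).2].
  by rewrite powR0 ?mulr0// gt_eqF.
have bound n i j : (j - i <= n)%N -> (i <= j)%N -> omega (tau i) (tau j) <= om0 ->
    `|y j - mu (tau i) (tau j) (y i)|
      <= K * (1 + `|y i|) * omega (tau i) (tau j) `^ th.
  elim: n i j => [|n IH] i j.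
    rewrite leqn0 subn_eq0 => ji ij; have -> : j = i by apply/eqP; rewrite eqn_leq ji.
    by rewrite muid subrr normr0 => _; rewrite !mulr_ge0 ?powR_ge0//; lra.
  move=> jin; rewrite leq_eqVlt => /predU1P[->|ij].
    by rewrite muid subrr normr0 => _; rewrite !mulr_ge0 ?powR_ge0//; lra.
  move=> wom; set W := omega (tau i) (tau j) in wom *.
  have W0 : 0 <= W by exact: w0 (ltnW ij).
  pose P k := omega (tau i) (tau k) <= 2^-1 * W.
  have Pi : P i.
    rewrite /P; case: sw => _ _ -> //; [|exact: (tauT i).1|exact: (tauT i).2].
    by rewrite mulr_ge0 ?invr_ge0.
  have [k [ik kj Pk Pk1]] := nat_split ij Pi.
  have [kin kjn] := subn_split jin ik kj.
  (* By superadditivity the part beyond k.+1 also carries at most half of W. *)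
  have wk1 : omega (tau k.+1) (tau j) <= 2^-1 * W.
    move: (kj); rewrite leq_eqVlt => /predU1P[->|k1j].
      case: sw => _ _ -> //; [|exact: (tauT j).1|exact: (tauT j).2].
      by rewrite mulr_ge0 ?invr_ge0.
    have := Pk1 k1j; rewrite /P -ltNge => h.
    have := wadd i k.+1 j (leqW ik) kj; rewrite -/W; lra.
  have [X [X0 Xd WrX WtX]] := small i j (ltnW ij) wom.
  have [ar1 ar2 ar3] := @splitting_arith R a C1 K X delta a0 a1 C0 erefl X0 Xd erefl.
  set M := 1 + `|y i|.
  have M1 : 1 <= M by rewrite /M lerDl.
  have M0 : 0 <= M by exact: le_trans M1.
  have KM0 : 0 <= K * M by rewrite mulr_ge0.
  set Wt := W `^ th.
  have Wt0 : 0 <= Wt by exact: powR_ge0.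
  have halfW v : 0 <= v -> v <= 2^-1 * W -> v `^ th <= a * Wt.
    move=> v0 vW; apply: (le_trans (ler_powRl (ltW th0) v0 vW)).
    by rewrite powRM ?invr_ge0.
  have wk : omega (tau i) (tau k) <= W by exact: wle (leqnn i) ik (ltnW kj).
  have Dk : `|y k - mu (tau i) (tau k) (y i)| <= K * M * (a * Wt).
    apply: (le_trans (IH _ _ kin ik (le_trans wk wom))).
    by apply: ler_wpM2l; [|exact: halfW (w0 _ _ ik) Pk].
  have KM1 : 1 <= K * M by rewrite -[leLHS]mulr1 ler_pM.
  have Dk' : `|y k - mu (tau i) (tau k) (y i)| <= K * M * Wt.
    apply: (le_trans Dk); rewrite ler_wpM2l//.
    by rewrite ler_piMl.
  have XW (c : R) : 0 <= c -> c * Wt * W `^ rho <= c * Wt * X.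
    by move=> c0; rewrite ler_wpM2l// mulr_ge0.
  have step l l' : (i <= l)%N -> (l <= l')%N -> (l' <= j)%N ->
      `|y l - mu (tau i) (tau l) (y i)| <= K * M * Wt ->
      `|y l' - mu (tau i) (tau l') (y i)| <=
      `|y l' - mu (tau l) (tau l') (y l)| + `|y l - mu (tau i) (tau l) (y i)|
      + (C1 * K * X + C1) * M * Wt.
    move=> il ll' l'j Dl.
    have [_ gl] := gauge (tau l) (tau l') W (tauT l).1 (taui _ _ ll') (tauT l').2
       (wle _ _ _ _ il ll' l'j) (wOm _ _ (ltnW ij)).
    have := gl (K * M) (y l) (mu (tau i) (tau l) (y i)) KM1 Dl.
    have := A2 (tau i) (tau l) (tau l') (y i) (tauT i).1 (taui _ _ il)
       (taui _ _ ll') (tauT l').2.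
    rewrite -/th -/M -/Wt => h1 h2.
    have h3 : C * M * omega (tau i) (tau l') `^ th <= C1 * M * Wt.
      apply: ler_pM; rewrite ?powR_ge0//; first by rewrite mulr_ge0.
        by rewrite ler_wpM2r.
      apply: ler_powRl; [exact: ltW|exact/w0/(leq_trans il ll')|].
      exact: wle (leqnn i) (leq_trans il ll') l'j.
    have h4 := XW _ (mulr_ge0 C0 KM0).
    have -> : (C1 * K * X + C1) * M * Wt = C1 * (K * M) * Wt * X + C1 * M * Wt by ring.
    have h5 : `|y l' - mu (tau i) (tau l') (y i)| <=
      `|y l' - mu (tau l) (tau l') (y l)|
      + `|mu (tau l) (tau l') (y l) - mu (tau l) (tau l') (mu (tau i) (tau l) (y i))|
      + `|mu (tau l) (tau l') (mu (tau i) (tau l) (y i)) - mu (tau i) (tau l') (y i)|.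
      exact: ler_distD3.
    lra.
  (* The scheme makes no error on the grid step from k to k.+1. *)
  have Dk1 : `|y k.+1 - mu (tau i) (tau k.+1) (y i)| <= (K * a + C1 * K * X + C1) * (M * Wt).
    have := step k k.+1 ik (leqnSn k) kj Dk'.
    rewrite -ys subrr normr0 add0r => h.
    have -> : (K * a + C1 * K * X + C1) * (M * Wt) =
       K * M * (a * Wt) + (C1 * K * X + C1) * M * Wt by ring.
    lra.
  have MW0 : 0 <= M * Wt by rewrite mulr_ge0.
  have Dk1' : `|y k.+1 - mu (tau i) (tau k.+1) (y i)| <= K * M * Wt.
    have -> : K * M * Wt = K * (M * Wt) by rewrite mulrA.
    by apply: (le_trans Dk1); rewrite ler_wpM2r.
  have := step k.+1 j (leqW ik) kj (leqnn j) Dk1'.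
  have gr := growth i j k.+1 (leqW ik) kj wom Dk1' X WrX WtX.
  have wk1W : omega (tau k.+1) (tau j) <= W by exact: wle (leqW ik) kj (leqnn j).
  have Dj : `|y j - mu (tau k.+1) (tau j) (y k.+1)| <=
     a * K * (1 + K * X + C1 * X) * (M * Wt).
    apply: (le_trans (IH _ _ kjn kj (le_trans wk1W wom))).
    have -> : a * K * (1 + K * X + C1 * X) * (M * Wt) =
      K * (M * (1 + K * X + C1 * X)) * (a * Wt) by ring.
    apply: ler_pM; rewrite ?powR_ge0//.
    - by rewrite mulr_ge0// addr_ge0.
    - by rewrite ler_wpM2l.
    - exact: halfW (w0 _ _ kj) wk1.
  move=> h.
  have := ler_wpM2r MW0 ar2.
  move=> ar; have e1 : (a * K * (1 + K * X + C1 * X) + (K * a + C1 * K * X + C1)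
      + C1 * K * X + C1) * (M * Wt) =
    a * K * (1 + K * X + C1 * X) * (M * Wt) + (K * a + C1 * K * X + C1) * (M * Wt)
    + (C1 * K * X + C1) * M * Wt by ring.
  have -> : K * M * Wt = K * (M * Wt) by rewrite mulrA.
  lra.
move=> i j ij wom; have Dj := bound _ _ _ (leqnn _) ij wom; split=> //.
have [X [X0 Xd WrX WtX]] := small i j ij wom.
have [_ _ ar3] := @splitting_arith R a C1 K X delta a0 a1 C0 erefl X0 Xd erefl.
apply: (le_trans (growth i j j ij (leqnn j) wom Dj X WrX WtX)).
by rewrite mulrC ler_wpM2r ?addr_ge0//; lra.
Qed.

(** The growth factor of a piece with omega <= omega0 is at most 2, so what
    remains is to count pieces.  A single grid step may carry a large omega; the
    first condition of an almost flow bounds its growth factor.  On intervals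
    with omega > omega0 the error bound follows from boundedness alone, as
    omega^theta is bounded below there. *)
Lemma scheme_global (R : realType) (E : normedModType R)
    (T kappa gamma C : R) (omega : R -> R -> R) (mu : R -> R -> E -> E) (a : E) :
  0 < kappa -> 0 < gamma -> gamma <= 1 -> 1 < (2 + gamma) * kappa ->
  0 <= C -> superadditive T omega -> almost_flow T kappa gamma C omega mu ->
  exists K B : R, forall tau y,
    times T tau -> scheme mu tau y -> y 0%N = a ->
    (forall i, `|y i| <= B) /\
    forall i j, (i <= j)%N -> `|y j - mu (tau i) (tau j) (y i)|
      <= K * omega (tau i) (tau j) `^ ((2 + gamma) * kappa).
Proof.
move=> k0 g0 g1 th1 C0 sw af.
have [K [om0 [K0 o0 loc]]] := scheme_local k0 g0 g1 th1 C0 sw af.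
have [A1 _ _] := af.
set th := (2 + gamma) * kappa in th1 loc *.
pose Q := C * omega 0 T `^ kappa.
have Q0 : 0 <= Q by rewrite mulr_ge0 ?powR_ge0.
pose L := 2 * (1 + Q).
have L1 : 1 <= L by rewrite /L; lra.
pose N := Num.bound (omega 0 T / om0).
pose B := L ^+ N.+1 * (1 + `|a|).
have B0 : 0 <= B by rewrite mulr_ge0 ?exprn_ge0 ?addr_ge0//; lra.
exists (K * B + B * (2 + Q) / om0 `^ th), B => tau y tauP ys ya.
have [tauT taui] := tauP.
have w0 i j : (i <= j)%N -> 0 <= omega (tau i) (tau j).
  by move=> ij; case: sw => + _ _; apply; [exact: (tauT i).1|exact: taui|exact: (tauT j).2].
have wOm i j : (i <= j)%N -> omega (tau i) (tau j) <= omega 0 T.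
  by move=> ij; apply: (superadditive_le sw); rewrite ?taui//;
    [exact: (tauT i).1|exact: (tauT j).2].
have wadd i k j : (i <= k)%N -> (k <= j)%N ->
    omega (tau i) (tau k) + omega (tau k) (tau j) <= omega (tau i) (tau j).
  by move=> ik kj; case: sw => _ + _; apply; rewrite ?taui//;
    [exact: (tauT i).1|exact: (tauT j).2].
have wii i : omega (tau i) (tau i) = 0.
  by case: sw => _ _ -> //; [exact: (tauT i).1|exact: (tauT i).2].
have incr i j z : (i <= j)%N -> `|mu (tau i) (tau j) z - z| <= Q * (1 + `|z|).
  move=> ij; apply: (le_trans (A1 _ _ z (tauT i).1 (taui _ _ ij) (tauT j).2)).
  rewrite /Q mulrAC ler_wpM2r ?addr_ge0// ler_wpM2l//.
  by apply: ler_powRl; [exact: ltW|exact: w0|exact: wOm].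
have M0 i : 0 <= 1 + `|y i| by rewrite addr_ge0.
have growth n i j : (i <= j)%N -> omega (tau i) (tau j) <= n%:R * om0 ->
    1 + `|y j| <= L ^+ n.+1 * (1 + `|y i|).
  have L2 : 2 <= L by rewrite /L; lra.
  elim: n i j => [|n IH] i j ij wij.
    rewrite mul0r in wij.
    have [_ h] := loc tau y tauP ys i j ij (le_trans wij (ltW o0)).
    by apply: (le_trans h); rewrite expr1 ler_wpM2r.
  have [small|big] := leP (omega (tau i) (tau j)) om0.
    have [_ h] := loc tau y tauP ys i j ij small.
    apply: (le_trans h); rewrite ler_wpM2r// exprS -[leLHS]mulr1 ler_pM//.
    exact: exprn_ege1.
  (* One piece with omega <= om0, then one grid step: together they carry more
     than om0, which leaves at most n om0 for the rest. *)
  have ltij : (i < j)%N.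
    by move: ij big; rewrite leq_eqVlt => /predU1P[->|//]; rewrite wii ltNge ltW.
  have Pi : omega (tau i) (tau i) <= om0 by rewrite wii ltW.
  have [k [ik kj Pk Pk1]] := @nat_split (fun k => omega (tau i) (tau k) <= om0) i j ltij Pi.
  have [_ hk] := loc tau y tauP ys i k ik Pk.
  have hk1 : 1 + `|y k.+1| <= L * (1 + `|y i|).
    have h : `|y k.+1| <= `|y k.+1 - y k| + `|y k|.
      by rewrite -{1}(subrK (y k) (y k.+1)) ler_normD.
    have := incr k k.+1 (y k) (leqnSn k); rewrite -ys => h'.
    have : (1 + Q) * (1 + `|y k|) <= (1 + Q) * (2 * (1 + `|y i|)).
      by rewrite ler_wpM2l// addr_ge0.
    rewrite /L; lra.
  have wk1 : omega (tau k.+1) (tau j) <= n%:R * om0.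
    move: (kj); rewrite leq_eqVlt => /predU1P[->|k1j].
      by rewrite wii mulr_ge0// ltW.
    have := Pk1 k1j; rewrite -ltNge => h.
    have := wadd i k.+1 j (leqW ik) kj.
    by rewrite -natr1 in wij; lra.
  apply: (le_trans (IH k.+1 j kj wk1)).
  by rewrite [L ^+ n.+2]exprSr -mulrA ler_wpM2l// exprn_ge0//; lra.
have NOm : omega 0 T <= N%:R * om0.
  rewrite -ler_pdivrMr// ltW// archi_boundP// divr_ge0 ?(ltW o0)//.
  by rewrite (le_trans (w0 0%N 0%N (leqnn _)) (wOm 0%N 0%N (leqnn _))).
have yB i : 1 + `|y i| <= B.
  by have := growth N 0%N i (leq0n _) (le_trans (wOm _ _ (leq0n _)) NOm); rewrite ya.
split=> [i|i j ij]; first by have := yB i; lra.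
have p0 : 0 < om0 `^ th by exact: powR_gt0.
have w1 : 0 <= omega (tau i) (tau j) `^ th by exact: powR_ge0.
have q0 : 0 <= B * (2 + Q) by rewrite mulr_ge0//; lra.
have q1 : 0 <= B * (2 + Q) / om0 `^ th by rewrite divr_ge0// ltW.
have [small|big] := leP (omega (tau i) (tau j)) om0.
  have [h _] := loc tau y tauP ys i j ij small.
  apply: (le_trans h); rewrite ler_wpM2r// -[leLHS]addr0 lerD// ler_wpM2l//.
apply: (@le_trans _ _ (B * (2 + Q))); last first.
  have h0 : 0 <= K * B * omega (tau i) (tau j) `^ th.
    by apply: mulr_ge0 => //; exact: mulr_ge0.
  have h1 : B * (2 + Q) * 1 <= B * (2 + Q) * (omega (tau i) (tau j) `^ th / om0 `^ th).
    apply: ler_wpM2l => //; rewrite ler_pdivlMr// mul1r.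
    by apply: ler_powRl; [lra|exact: ltW|exact: ltW].
  rewrite mulrDl -[B * (2 + Q) / _ * _]mulrA [_^-1 * _]mulrC; lra.
have h1 := incr i j (y i) ij.
have h2 := ler_distD (y i) (y j) (mu (tau i) (tau j) (y i)).
rewrite (distrC (y i)) in h2.
have h3 := ler_normB (y j) (y i).
have := yB i; have := yB j => e1 e2.
have : Q * (1 + `|y i|) <= Q * B by rewrite ler_wpM2l.
lra.
Qed.

(** * From finite grids to a path *)

Lemma finite_solution (R : realType) (E : normedModType R) (T K B theta : R)
    (omega : R -> R -> R) (mu : R -> R -> E -> E) (a : E) (F : seq R) :
  0 <= T ->
  (forall tau y, times T tau -> scheme mu tau y -> y 0%N = a ->
    (forall i, `|y i| <= B) /\
    forall i j, (i <= j)%N -> `|y j - mu (tau i) (tau j) (y i)|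
      <= K * omega (tau i) (tau j) `^ theta) ->
  exists g : R -> E, [/\ g 0 = a, forall t, `|g t| <= B &
    forall s t, s \in F -> t \in F -> 0 <= s -> s <= t -> t <= T ->
    `|g t - mu s t (g s)| <= K * omega s t `^ theta].
Proof.
move=> T0 H.
pose l := sort <=%O (0 :: [seq t <- F | (0 <= t) && (t <= T)]).
have lT t : t \in l -> 0 <= t /\ t <= T.
  rewrite mem_sort inE mem_filter => /predU1P[->|]; first by rewrite lexx.
  by case/andP => /andP[].
have ls : sorted <=%O l by apply: sort_sorted; exact: le_total.
have l0 : (0 < size l)%N by rewrite size_sort.
(* The default value T keeps tau nondecreasing beyond the end of the grid. *)
pose tau i := nth T l i.
have tauT i : 0 <= tau i /\ tau i <= T.
  rewrite /tau; case: (ltnP i (size l)) => il; first exact/lT/mem_nth.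
  by rewrite nth_default.
have taui i j : (i <= j)%N -> tau i <= tau j.
  move=> ij; case: (ltnP j (size l)) => jl.
    exact: (sorted_leq_nth le_trans le_refl T ls i j (leq_ltn_trans ij jl) jl ij).
  by rewrite [tau j]nth_default// (tauT i).2.
pose y := fix y i := if i is i'.+1 then mu (tau i') (tau i) (y i') else a.
have ys : scheme mu tau y by [].
have [yB yD] := H tau y (conj tauT taui) ys erefl.
exists (fun t => y (index t l)); split.
- have in0 : 0 \in l by rewrite mem_sort inE eqxx.
  have /eqP -> // : index 0 l == 0%N.
  rewrite -leqn0 leqNgt; apply/negP => i0.
  have := taui 0%N _ (ltnW i0); rewrite /tau nth_index// => h.
  have e0 : nth T l 0 = 0 by apply/eqP; rewrite eq_le h (lT _ (mem_nth _ l0)).1.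
  have := before_find T i0; rewrite e0 /= eqxx//.
- by move=> t; exact: yB.
- move=> s t sF tF s0 st tT.
  have sl : s \in l by rewrite mem_sort inE mem_filter s0 sF (le_trans st tT) orbT.
  have tl : t \in l by rewrite mem_sort inE mem_filter tT tF (le_trans s0 st) orbT.
  have ij : (index s l <= index t l)%N.
    case: leqP => // ji; have := taui _ _ (ltnW ji).
    rewrite /tau !nth_index// => ts.
    have e : s = t by apply/eqP; rewrite eq_le st.
    by rewrite e ltnn in ji.
  by have := yD _ _ ij; rewrite /tau !nth_index.
Qed.

Lemma almost_flow_continuous (R : realType) (E : normedModType R)
    (T kappa gamma C : R) (omega : R -> R -> R) (mu : R -> R -> E -> E) (s t : R) :
  0 < gamma -> 0 <= C -> almost_flow T kappa gamma C omega mu ->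
  0 <= s -> s <= t -> t <= T -> continuous (mu s t).
Proof.
move=> g0 C0 [_ _ A3] s0 st tT y.
set c1 := omega s t `^ kappa; set c2 := omega s t `^ (2 * kappa).
have c10 : 0 <= C * c1 by rewrite mulr_ge0 ?powR_ge0.
have c20 : 0 <= C * c2 by rewrite mulr_ge0 ?powR_ge0.
apply/cvgrPdist_le => /= e e0.
pose d1 := e / (2 * (1 + C * c1)); pose d2 := e / (2 * (1 + C * c2)).
have d10 : 0 < d1 by rewrite divr_gt0// mulr_gt0//; lra.
have d20 : 0 < d2 by rewrite divr_gt0// mulr_gt0//; lra.
have e1 : (1 + C * c1) * d1 = e / 2 by rewrite /d1; field; rewrite gt_eqF//; lra.
have e2 : (1 + C * c2) * d2 = e / 2 by rewrite /d2; field; rewrite gt_eqF//; lra.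
near=> z.
have z1 : `|y - z| <= d1.
  by near: z; apply: cvgr_dist_le => //; exact: cvg_id.
have z2 : `|y - z| `^ gamma <= d2.
  apply: powR_le_root => //; first exact: ltW.
  by near: z; apply: cvgr_dist_le; [exact: cvg_id|exact: powR_gt0].
apply: (le_trans (A3 s t y z s0 st tT)); rewrite -/c1 -/c2.
have h1 : (1 + C * c1) * `|y - z| <= (1 + C * c1) * d1.
  by apply: ler_wpM2l => //; lra.
have h2 : (C * c2) * `|y - z| `^ gamma <= (C * c2) * d2.
  exact: ler_wpM2l.
lra.
Unshelve. all: by end_near.
Qed.

Lemma continuous_residual (X : topologicalType) (R : realType) (E : normedModType R)
    (u v : X -> E) (m : E -> E) :
  continuous u -> continuous v -> continuous m ->
  continuous (fun g => `|v g - m (u g)| : R).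
Proof.
move=> cu cv cm g; apply: cvg_norm; apply: cvgB; first exact: cv.
exact: (cvg_comp u m (cu g) (cm (u g))).
Qed.

(** Compactness replaces a limit along refining grids: the sets [G F] of paths
    meeting the conditions at the times in [F] generate a filter on the compact
    space of paths in a ball, and any cluster point meets all conditions, each
    of which is closed. *)
Theorem almost_flow_solution (R : realType) (E : normedModType R)
    (T kappa gamma C : R) (omega : R -> R -> R) (mu : R -> R -> E -> E) (a : E) :
  (forall B : R, compact [set y : E | `|y| <= B]) ->
  0 <= T -> 0 < kappa -> 0 < gamma -> gamma <= 1 -> 1 < (2 + gamma) * kappa ->
  0 <= C -> superadditive T omega -> almost_flow T kappa gamma C omega mu ->
  exists (y : R -> E) (K B : R), [/\ y 0 = a, forall t, `|y t| <= B &
    forall s t, 0 <= s -> s <= t -> t <= T ->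
    `|y t - mu s t (y s)| <= K * omega s t `^ ((2 + gamma) * kappa)].
Proof.
move=> cE T0 k0 g0 g1 th1 C0 sw af.
have [K [B H]] := scheme_global a k0 g0 g1 th1 C0 sw af.
pose X := prod_topology (fun _ : R => E).
pose D s t := K * omega s t `^ ((2 + gamma) * kappa).
pose G (F : seq R) : set X := [set g : X | [/\ g 0 = a, forall t, `|g t| <= B &
    forall s t, s \in F -> t \in F -> 0 <= s -> s <= t -> t <= T ->
    `|g t - mu s t (g s)| <= D s t]].
have cX : compact [set g : X | forall t, `|g t| <= B].
  exact: (@tychonoff R (fun=> E) (fun=> [set y : E | `|y| <= B])).
pose Fi : set_system X := filter_from [set: seq R] G.
have FiP : ProperFilter Fi.
  apply: filter_from_proper; last first.
    by move=> F _; have [g gP] := finite_solution F T0 H; exists g.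
  apply: filter_from_filter; first by exists [::].
  move=> F F' _ _; exists (F ++ F') => // g [ga gB gD].
  by split; split => // s t sF tF; apply: gD; rewrite mem_cat ?sF ?tF ?orbT.
have [|y [yB ycl]] := cX Fi FiP.
  by exists [::] => // g [].
have cl F (P : set X) : closed P -> G F `<=` P -> P y.
  move=> cP GP; apply: cP => A Ay.
  by apply: ycl => //; exists F.
have ev t : continuous (fun g : X => (g : R -> E) t) by exact: (@proj_continuous R (fun=> E) t).
exists y, K, B; split => //.
  have : [set g : X | (g : R -> E) 0 = a] y.
    apply: (cl [::]); last by move=> g [].
    apply: (@preimage_closed _ _ _ [set a]) => [g _|]; first exact: ev.
    exact: (accessible_closed_set1 (hausdorff_accessible (@norm_hausdorff _ E))) .
  by [].
move=> s t s0 st tT.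
have cmu := almost_flow_continuous g0 C0 af s0 st tT.
have : [set g : X | `|(g : R -> E) t - mu s t ((g : R -> E) s)| <= D s t] y.
  apply: (cl [:: s; t]); last first.
    by move=> g [_ _]; apply; rewrite ?inE ?eqxx ?orbT.
  have cr := continuous_residual (ev s) (ev t) cmu.
  apply: (@preimage_closed _ _ _ [set r : R | r <= D s t] (fun g _ => cr g)).
  exact: closed_le.
by [].
Qed.

(** * Norms of matrices *)

Lemma mx_entry_le (R : realType) (m n : nat) (A : 'M[R]_(m, n)) i j :
  `|A i j| <= `|A|.
Proof.
rewrite [leRHS]/Num.norm /= mx_normrE; apply/bigmax_geP; right => /=.
by exists (i, j).
Qed.

Lemma mx_norm_le (R : realType) (m n : nat) (A : 'M[R]_(m, n)) (c : R) :
  0 <= c -> (forall i j, `|A i j| <= c) -> `|A| <= c.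
Proof.
move=> c0 Ac; rewrite [leLHS]/Num.norm /= mx_normrE.
by apply/bigmax_leP; split => // -[i j] _; exact: Ac.
Qed.

Lemma mx_norm_sub (R : realType) (m n m' n' : nat) (A : 'M[R]_(m, n))
    (B : 'M[R]_(m', n')) :
  (forall i j, exists i' j', A i j = B i' j') -> `|A| <= `|B|.
Proof.
move=> AB; apply: mx_norm_le => // i j.
by have [i' [j' ->]] := AB i j; exact: mx_entry_le.
Qed.

Lemma mulmx_norm_le (R : realType) (m n k : nat) (A : 'M[R]_(m, n))
    (B : 'M[R]_(n, k)) : `|A *m B| <= n%:R * `|A| * `|B|.
Proof.
apply: mx_norm_le => [|i j]; first by rewrite !mulr_ge0.
rewrite !mxE; apply: (le_trans (ler_norm_sum _ _ _)).
apply: (@le_trans _ _ (\sum_(l < n) `|A| * `|B|)); last first.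
  by rewrite sumr_const card_ord -mulrA mulr_natl.
by apply: ler_sum => l _; rewrite normrM ler_pM// mx_entry_le.
Qed.

Lemma trmx_norm_le (R : realType) (m n : nat) (A : 'M[R]_(m, n)) : `|A^T| <= `|A|.
Proof. by apply: mx_norm_sub => i j; exists j, i; rewrite mxE. Qed.

Lemma tensor_norm_le (R : realType) (m n : nat) (u : 'cV[R]_m) (w : 'cV[R]_n) :
  `|tensor u w| <= `|u| * `|w|.
Proof.
apply: (le_trans (mulmx_norm_le _ _)); rewrite mul1r ler_wpM2l//.
exact: trmx_norm_le.
Qed.

Lemma contraction_continuous (R : realType) (V W : normedModType R) (g : V -> W) :
  (forall v w, `|g v - g w| <= `|v - w|) -> continuous g.
Proof.
move=> gP v; apply/cvgrPdist_le => e e0; near=> w.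
by apply: (le_trans (gP v w)); near: w; apply: cvgr_dist_le => //; exact: cvg_id.
Unshelve. all: by end_near.
Qed.

Lemma compact_mx_ball (R : realType) (m n : nat) (B : R) :
  compact [set y : 'M[R]_(m, n) | `|y| <= B].
Proof.
have c1 : compact [set v : 'rV[R]_(m * n) | `|v| <= B].
  apply: bounded_closed_compact.
    by exists B; split => [|C BC v /= vB]; [exact: num_real|exact/(le_trans vB)/ltW].
  apply: (@preimage_closed _ _ (fun v : 'rV[R]_(m * n) => `|v|) [set r : R | r <= B]).
    by move=> v _; exact: norm_continuous.
  exact: closed_le.
have -> : [set y : 'M[R]_(m, n) | `|y| <= B] =
    (@vec_mx R m n) @` [set v : 'rV[R]_(m * n) | `|v| <= B].
  apply/seteqP; split => [y /= yB|y [v /= vB <-]].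
    exists (mxvec y); last exact: mxvecK.
    apply: le_trans yB; apply: mx_norm_sub => i j; rewrite ord1.
    by case/mxvec_indexP: j => i' j'; exists i', j'; rewrite mxvecE.
  by apply: le_trans vB; apply: mx_norm_sub => i j; exists 0, (mxvec_index i j); rewrite mxE.
apply: continuous_compact c1; apply: continuous_subspaceT.
apply: contraction_continuous => v w.
rewrite -linearB.
by apply: mx_norm_sub => i j; exists 0, (mxvec_index i j); rewrite mxE.
Qed.

(** * Taylor remainder along a segment *)

(** A mean value inequality: summing over the [n] steps of a
    uniform subdivision leaves e + C n^(-gamma). *)
Lemma increment_le (R : realType) (E : normedModType R) (g : R -> E) (e C gamma : R) :
  0 < gamma -> 0 <= C ->
  (forall s h, 0 <= s -> 0 <= h -> s + h <= 1 ->
     `|g (s + h) - g s| <= e * h + C * h `^ (1 + gamma)) ->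
  `|g 1 - g 0| <= e.
Proof.
move=> g0 C0 H; apply/ler_addgt0Pr => d d0.
pose q := (d / (1 + C)) `^ gamma^-1.
have d1 : 0 < d / (1 + C) by rewrite divr_gt0//; lra.
have q0 : 0 < q by exact: powR_gt0.
pose n := (Num.bound q^-1).+1.
have n0 : 0 < n%:R :> R by rewrite ltr0n.
have nq : n%:R^-1 <= q.
  rewrite -[leRHS]invrK lef_pV2 ?posrE ?invr_gt0//.
  apply: (@le_trans _ _ (Num.bound q^-1)%:R); last by rewrite ler_nat.
  by rewrite ltW// archi_boundP// invr_ge0 ltW.
have h0 : 0 <= n%:R^-1 :> R by rewrite invr_ge0 ltW.
have hd : C * n%:R^-1 `^ gamma <= d.
  apply: (@le_trans _ _ (C * (d / (1 + C)))).
    by rewrite ler_wpM2l// powR_le_root// ltW.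
  rewrite mulrCA ger_pMr// ler_pdivrMr; lra.
set h : R := n%:R^-1 in h0 hd nq.
have tel k : (k <= n)%N -> `|g (k%:R * h) - g 0| <= k%:R * (e * h + C * h `^ (1 + gamma)).
  elim: k => [|k IH] kn; first by rewrite !mul0r subrr normr0.
  apply: (le_trans (ler_distD (g (k%:R * h)) _ _)).
  rewrite -natr1 [leRHS]mulrDl mul1r [leRHS]addrC mulrDl mul1r.
  apply: lerD; last exact/IH/ltnW.
  apply: H => //; first by rewrite mulr_ge0.
  by rewrite -{2}[h]mul1r -mulrDl natr1 /h ler_pdivrMr// mul1r ler_nat.
have := tel n (leqnn n); rewrite mulfV ?gt_eqF// => /le_trans; apply.
have -> : n%:R * (e * h + C * h `^ (1 + gamma)) =
   (n%:R * h) * e + (n%:R * h) * (C * h `^ gamma).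
  rewrite powRD; last by rewrite gt_eqF// addr_gt0.
  by rewrite powRr1//; ring.
by rewrite mulfV ?gt_eqF// !mul1r lerD2l.
Qed.

(** The hypothesis is tested against the one direction [v] and the one vector
    [w]: only there is the oscillation of Df controlled by that of f.Df, see
    euler_defect. *)
Lemma taylor_along (R : realType) (d m : nat) (gamma c e : R)
    (f : 'cV[R]_d -> 'M[R]_(d, m))
    (Df : 'cV[R]_d -> {linear 'cV[R]_d -> 'M[R]_(d, m)})
    (y v : 'cV[R]_d) (w : 'cV[R]_m) :
  0 < gamma -> 0 <= c ->
  (forall u u' : 'cV[R]_d,
        `|f u - f u' - Df u' (u - u')| <= c * `|u - u'| `^ (1 + gamma)) ->
  (forall tau : R, 0 <= tau -> tau <= 1 ->
     `|(Df (y + tau *: v) v - Df y v) *m w| <= e) ->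
  `|(f (y + v) - f y - Df y v) *m w| <= e.
Proof.
move=> g0 c0 T H.
pose g tau := (f (y + tau *: v) - tau *: Df y v) *m w.
have -> : (f (y + v) - f y - Df y v) *m w = g 1 - g 0.
  by rewrite /g !scale1r !scale0r addr0 subr0 -mulmxBl addrAC.
apply: (@increment_le _ _ g e (m%:R * c * `|v| `^ (1 + gamma) * `|w|) gamma) => //.
  by rewrite !mulr_ge0 ?powR_ge0.
move=> s h s0 h0 sh.
have -> : g (s + h) - g s =
    (f (y + (s + h) *: v) - f (y + s *: v) - Df (y + s *: v) (h *: v)) *m w
    + h *: ((Df (y + s *: v) v - Df y v) *m w).
  have -> : Df (y + s *: v) (h *: v) = h *: Df (y + s *: v) v by exact: linearZ.
  rewrite /g -mulmxBl scalemxAl -mulmxDl; congr (_ *m _). apply/matrixP => i j; rewrite !mxE; ring.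
rewrite addrC; apply: (le_trans (ler_normD _ _)); apply: lerD.
  rewrite normrZ ger0_norm// mulrC ler_wpM2r//; apply: H => //; lra.
apply: (le_trans (mulmx_norm_le _ _)).
have -> : m%:R * c * `|v| `^ (1 + gamma) * `|w| * h `^ (1 + gamma) =
  m%:R * (c * (h `^ (1 + gamma) * `|v| `^ (1 + gamma))) * `|w| by ring.
rewrite ler_wpM2r// ler_wpM2l//.
have := T (y + (s + h) *: v) (y + s *: v).
have -> : y + (s + h) *: v - (y + s *: v) = h *: v.
  by rewrite scalerDl; apply/matrixP => i j; rewrite !mxE; ring.
by rewrite normrZ (ger0_norm h0) powRM.
Qed.

(** * Increments of a path in the truncated tensor algebra *)

Lemma T2incr_lev1 (R : realType) (n : nat) (x : R -> T2 R n) (s t : R) :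
  lev0 (x s) = 1 -> lev0 (x t) = 1 ->
  lev1 (T2incr x s t) = lev1 (x t) - lev1 (x s).
Proof.
move=> xs xt; rewrite /T2incr /T2mul /T2inv /= xs xt.
by rewrite expr1n invr1 !scale1r.
Qed.

Lemma T2incr_lev2 (R : realType) (n : nat) (x : R -> T2 R n) (s t : R) :
  lev0 (x s) = 1 -> lev0 (x t) = 1 ->
  lev2 (T2incr x s t) =
    lev2 (x t) - lev2 (x s) - tensor (lev1 (x s)) (lev1 (x t) - lev1 (x s)).
Proof.
move=> xs xt; rewrite /T2incr /T2mul /T2inv /= xs xt.
rewrite !expr1n invr1 !scale1r /tensor mulNmx linearB /= mulmxBr.
apply/matrixP => i j; rewrite !mxE; ring.
Qed.

Lemma tensorDr (R : realType) (m n : nat) (u : 'cV[R]_m) (w w' : 'cV[R]_n) :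
  tensor u (w + w') = tensor u w + tensor u w'.
Proof. by rewrite /tensor linearD mulmxDr. Qed.

Lemma tensorB (R : realType) (m n : nat) (u u' : 'cV[R]_m) (w : 'cV[R]_n) :
  tensor (u - u') w = tensor u w - tensor u' w.
Proof. exact: mulmxBl. Qed.

Lemma chen (R : realType) (n : nat) (x : R -> T2 R n) (s r t : R) :
  lev0 (x s) = 1 -> lev0 (x r) = 1 -> lev0 (x t) = 1 ->
  lev1 (T2incr x s t) = lev1 (T2incr x s r) + lev1 (T2incr x r t) /\
  lev2 (T2incr x s t) = lev2 (T2incr x s r) + lev2 (T2incr x r t)
    + tensor (lev1 (T2incr x s r)) (lev1 (T2incr x r t)).
Proof.
move=> xs xr xt; rewrite !T2incr_lev1// !T2incr_lev2//; split.
  by apply/matrixP => i j; rewrite !mxE; ring.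
have -> : lev1 (x t) - lev1 (x s) = (lev1 (x r) - lev1 (x s)) + (lev1 (x t) - lev1 (x r)).
  by apply/matrixP => i j; rewrite !mxE; ring.
rewrite [tensor (lev1 (x s)) _]tensorDr tensorB.
apply/matrixP => i j; rewrite !mxE; ring.
Qed.

(** * The Euler step *)

(** A single constant for all the estimates, so that products of them are
    powers of [c].  The last condition uses |v|^gamma <= 1 + |v|. *)
Definition field_bounds (R : realType) (d m : nat) (gamma c : R)
    (f : 'cV[R]_d -> 'M[R]_(d, m))
    (Df : 'cV[R]_d -> {linear 'cV[R]_d -> 'M[R]_(d, m)}) : Prop :=
  [/\ (forall u u', `|f u - f u'| <= c * `|u - u'|) /\
      (forall u, `|f u| <= c * (1 + `|u|)),
      forall u h, `|Df u h| <= c * `|h|,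
      forall u u' : 'cV[R]_d,
        `|f u - f u' - Df u' (u - u')| <= c * `|u - u'| `^ (1 + gamma),
      forall u u' X, `|f_nabla_f f Df u X - f_nabla_f f Df u' X|
                       <= c * `|u - u'| `^ gamma * `|X|
    & forall u X, `|f_nabla_f f Df u X| <= c * (1 + `|u|) * `|X|].

Lemma powR_le1D (R : realType) (a gamma : R) :
  0 <= a -> 0 <= gamma -> gamma <= 1 -> a `^ gamma <= 1 + a.
Proof.
move=> a0 g0 g1; apply: (@le_trans _ _ ((1 + a) `^ gamma)).
  by apply: ler_powRl => //; lra.
by apply: ler1_powR => //; lra.
Qed.

Lemma lip1_field_bounds (R : realType) (d m : nat) (gamma : R)
    (f : 'cV[R]_d -> 'M[R]_(d, m))
    (Df : 'cV[R]_d -> {linear 'cV[R]_d -> 'M[R]_(d, m)}) :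
  0 < gamma -> gamma <= 1 -> lip1 gamma f Df ->
  op_holder gamma
      (fun v : 'cV[R]_d => f_nabla_f f Df v : {linear 'M[R]_m -> 'cV[R]_d}) ->
  exists c0 : R, forall c, c0 <= c -> field_bounds gamma c f Df.
Proof.
move=> g0 g1 [[k kf] [C1 DB] _ [C2 Tay]] [C3 P].
pose C4 := \sum_(i < m) \sum_(j < m) `|col j (Df 0 (col i (f 0)))|.
have C40 : 0 <= C4 by apply: sumr_ge0 => i _; exact: sumr_ge0.
(* A bound at the point 0; Hoelder continuity carries it to the other points. *)
have P0 X : `|f_nabla_f f Df 0 X| <= C4 * `|X|.
  rewrite /f_nabla_f /C4 mulr_suml; apply: (le_trans (ler_norm_sum _ _ _)).
  apply: ler_sum => i _; rewrite mulr_suml; apply: (le_trans (ler_norm_sum _ _ _)).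
  apply: ler_sum => j _; rewrite normrZ mulrC ler_wpM2l// mx_entry_le//.
exists (`|k| + `|f 0| + `|C1| + `|C2| + `|C3| + C4) => c hc.
have [h1 h2 h3 h4] := And4 (normr_ge0 k) (normr_ge0 C1) (normr_ge0 C2) (normr_ge0 C3).
have h5 := normr_ge0 (f 0).
have [q1 q2 q3 q4] := And4 (ler_norm k) (ler_norm C1) (ler_norm C2) (ler_norm C3).
have kl u u' : `|f u - f u'| <= k * `|u - u'| by exact: (kf (u, u') (conj I I)).
split; [split|..].
- by move=> u u'; apply: (le_trans (kl u u')); rewrite ler_wpM2r//; lra.
- move=> u; have := kl u 0; rewrite subr0 => h.
  have : `|f u| <= `|f u - f 0| + `|f 0| by rewrite -{1}(subrK (f 0) (f u)) ler_normD.
  have h' : k * `|u| <= (c - `|f 0|) * `|u| by rewrite ler_wpM2r//; lra.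
  have : 0 <= `|f 0| * `|u| by rewrite mulr_ge0.
  lra.
- by move=> u h; apply: (le_trans (DB u h)); rewrite ler_wpM2r//; lra.
- by move=> u u'; apply: (le_trans (Tay u u')); rewrite ler_wpM2r ?powR_ge0//; lra.
- move=> u u' X; apply: (le_trans (P u u' X)); rewrite -!mulrA.
  by rewrite ler_wpM2r ?mulr_ge0 ?powR_ge0//; lra.
- move=> u X; have := P u 0 X; rewrite subr0 /= => h.
  have e : `|f_nabla_f f Df u X| <=
      `|f_nabla_f f Df u X - f_nabla_f f Df 0 X| + `|f_nabla_f f Df 0 X|.
    by rewrite -{1}(subrK (f_nabla_f f Df 0 X) (f_nabla_f f Df u X)) ler_normD.
  have e0 := P0 X.
  have u1 : `|u| `^ gamma <= 1 + `|u| by apply: powR_le1D => //; exact: ltW.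
  have e1 : C3 * `|u| `^ gamma * `|X| <= `|C3| * (1 + `|u|) * `|X|.
    rewrite ler_wpM2r//; apply: (@le_trans _ _ (`|C3| * `|u| `^ gamma)).
      by rewrite ler_wpM2r ?powR_ge0.
    by rewrite ler_wpM2l.
  have e2 : C4 * `|X| <= C4 * (1 + `|u|) * `|X|.
    by rewrite ler_wpM2r// ler_peMr// lerDl.
  have e3 : (`|C3| + C4) * ((1 + `|u|) * `|X|) <= c * ((1 + `|u|) * `|X|).
    by rewrite ler_wpM2r ?mulr_ge0 ?addr_ge0//; lra.
  rewrite -mulrA; lra.
Qed.

(** Two successive Euler steps with increments (u, P) and (w, Q), compared with
    the single step over their Chen product.  The scale is h = omega^(1/p), so
    that h^2 h^gamma is omega^theta.  The powers of [c] and the factor 6 come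
    from crude counting. *)
Lemma euler_defect (R : realType) (d m : nat) (gamma c h : R)
    (f : 'cV[R]_d -> 'M[R]_(d, m))
    (Df : 'cV[R]_d -> {linear 'cV[R]_d -> 'M[R]_(d, m)})
    (y : 'cV[R]_d) (u w : 'cV[R]_m) (P Q : 'M[R]_m) :
  0 < gamma -> gamma <= 1 -> field_bounds gamma c f Df ->
  1 <= c -> m%:R <= c -> 0 <= h -> h <= c -> h <= c * h `^ gamma ->
  `|u| <= c * h -> `|w| <= c * h -> `|P| <= c * h ^+ 2 -> `|Q| <= c * h ^+ 2 ->
  let y' := y + (f y *m u + f_nabla_f f Df y P) in
  `|y' - y| <= 2 * c ^+ 3 * (1 + `|y|) * h /\
  `|y' + (f y' *m w + f_nabla_f f Df y' Q)
    - (y + (f y *m (u + w) + f_nabla_f f Df y (P + Q + tensor u w)))|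
    <= 6 * c ^+ 10 * (1 + `|y|) * (h ^+ 2 * h `^ gamma).
Proof.
move=> g0 g1 [[fL fB] DB Tay psiH psiB] c1 mc h0 hc hg hu hw hP hQ y'.
have c0 : 0 <= c by lra.
set psi := f_nabla_f f Df in psiH psiB y' *.
set M := 1 + `|y|; have M1 : 1 <= M by rewrite /M lerDl.
have M0 : 0 <= M by lra.
set g := h `^ gamma in hg *; have gg0 : 0 <= g by exact: powR_ge0.
have mulm (k : nat) (A : 'M[R]_(k, m)) l (B : 'M[R]_(m, l)) : `|A *m B| <= c * `|A| * `|B|.
  by apply: (le_trans (mulmx_norm_le _ _)); rewrite -!mulrA ler_wpM2r// mulr_ge0.
have mulmle (k : nat) (A : 'M[R]_(k, m)) l (B : 'M[R]_(m, l)) a b :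
   `|A| <= a -> `|B| <= b -> `|A *m B| <= c * a * b.
  move=> Aa Bb; apply: (le_trans (mulm _ _ _ _)).
  by apply: ler_pM => //; [rewrite mulr_ge0|rewrite ler_wpM2l].
pose v := f y *m u; pose q := psi y P.
have hv : `|v| <= c ^+ 3 * M * h.
  apply: (le_trans (mulmle _ _ _ _ _ _ (fB y) hu)).
  by rewrite -/M (_ : c * _ * _ = c ^+ 3 * M * h)//; ring.
have hq : `|q| <= c ^+ 2 * M * h ^+ 2.
  apply: (le_trans (psiB y P)); rewrite -/M.
  have -> : c ^+ 2 * M * h ^+ 2 = c * M * (c * h ^+ 2) by ring.
  by rewrite ler_wpM2l// mulr_ge0.
have cM0 k : 0 <= c ^+ k * M by rewrite mulr_ge0// exprn_ge0.
have yE : y' = y + v + q by rewrite /y' -/v -/q addrA.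
have hy : `|y' - y| <= 2 * c ^+ 3 * M * h.
  have -> : y' - y = v + q by rewrite yE addrAC [y + v]addrC addrK.
  apply: (le_trans (ler_normD _ _)).
  have : c ^+ 2 * M * h ^+ 2 <= c ^+ 3 * M * h.
    rewrite expr2 mulrA mulrAC -[c ^+ 2 * M * h * h]mulrA.
    have -> : c ^+ 3 * M * h = c ^+ 2 * M * h * c by ring.
    by rewrite mulrA ler_wpM2l// mulr_ge0.
  lra.
split=> //.
(* The defect is the sum of the error of replacing y' by y + v, the Taylor
   remainder along v, and the oscillation of f.Df; the term Df y v *m w is
   the value of f.Df on u (x) w. *)
pose A1 := (f (y + v + q) - f (y + v)) *m w.
pose A2 := (f (y + v) - f y - Df y v) *m w.
pose A3 := psi y' Q - psi y Q.
have -> : y' + (f y' *m w + psi y' Q) - (y + (f y *m (u + w) + psi y (P + Q + tensor u w)))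
  = A1 + A2 + A3.
  have eP : psi y (P + Q + tensor u w) = psi y P + psi y Q + Df y v *m w.
    rewrite /psi -f_nabla_f_tensor -!linearD. by [].
  rewrite eP /A1 /A2 /A3 -yE {1}yE mulmxDr !mulmxBl.
  by apply/matrixP => i j; rewrite !mxE; ring.
pose Z := M * (h ^+ 2 * g).
have Z0 : 0 <= Z by rewrite !mulr_ge0// exprn_ge0.
have lift k (a : R) : (k <= 10)%N -> 0 <= a -> c ^+ k * a <= c ^+ 10 * a.
  by move=> k10 a0; rewrite ler_wpM2r// ler_weXn2l.
have h3 : h ^+ 3 <= c * (h ^+ 2 * g).
  have -> : h ^+ 3 = h ^+ 2 * h by ring.
  have -> : c * (h ^+ 2 * g) = h ^+ 2 * (c * g) by ring.
  by rewrite ler_wpM2l// exprn_ge0.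
have h3M k : c ^+ k * M * h ^+ 3 <= c ^+ k.+1 * Z.
  have -> : c ^+ k.+1 * Z = c ^+ k * M * (c * (h ^+ 2 * g)) by rewrite /Z exprSr; ring.
  by rewrite ler_wpM2l.
have Mg (k : nat) (z : 'cV[R]_d) : `|z| <= c ^+ k * M * h -> `|z| `^ gamma <= c ^+ k * M * g.
  move=> zM; apply: (le_trans (ler_powRl (ltW g0) _ zM)) => //.
  rewrite powRM// ler_wpM2r//; apply: ler1_powR => //.
  by rewrite -[leLHS]mulr1 ler_pM// exprn_ege1.
have hA1 : `|A1| <= c ^+ 10 * Z.
  apply: (@le_trans _ _ (c ^+ 5 * M * h ^+ 3)).
    apply: (le_trans (mulmle _ _ _ _ _ _ (fL _ _) hw)).
    have -> : y + v + q - (y + v) = q by rewrite addrC addKr.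
    have -> : c ^+ 5 * M * h ^+ 3 = c * (c * (c ^+ 2 * M * h ^+ 2)) * (c * h) by ring.
    by rewrite ler_wpM2r ?mulr_ge0// !ler_wpM2l.
  by apply: (le_trans (h3M 5)); exact: lift.
have hA3 : `|A3| <= 2 * (c ^+ 10 * Z).
  apply: (le_trans (psiH _ _ _)).
  have e : `|y' - y| `^ gamma <= 2 * c ^+ 3 * M * g.
    apply: (le_trans (ler_powRl (ltW g0) _ hy)) => //.
    rewrite powRM ?mulr_ge0// ?exprn_ge0// ler_wpM2r//; apply: ler1_powR => //.
    rewrite -[leLHS]mulr1 ler_pM// -[leLHS]mulr1 ler_pM// ?exprn_ege1//; lra.
  apply: (@le_trans _ _ (c * (2 * c ^+ 3 * M * g) * (c * h ^+ 2))).
    by apply: ler_pM => //; rewrite ?mulr_ge0 ?powR_ge0// ler_wpM2l.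
  have -> : c * (2 * c ^+ 3 * M * g) * (c * h ^+ 2) = 2 * (c ^+ 5 * Z).
    by rewrite /Z; ring.
  by rewrite ler_wpM2l// lift.
have hA2 : `|A2| <= 2 * (c ^+ 10 * Z).
  apply: (taylor_along g0 c0 Tay) => tau t0 t1.
  have htv : `|tau *: v| <= c ^+ 3 * M * h.
    by rewrite normrZ ger0_norm//; apply: le_trans hv; rewrite ler_piMl.
  set yt := y + tau *: v.
  have eyt : yt - y = tau *: v by rewrite /yt addrC addKr.
  (* f.Df y is Df y applied to v = f y *m u, but f.Df yt is Df yt applied to
     f yt *m u; the last term corrects for this. *)
  have -> : (Df yt v - Df y v) *m w =
      (psi yt (tensor u w) - psi y (tensor u w)) + Df yt ((f y - f yt) *m u) *m w.
    have -> : Df yt ((f y - f yt) *m u) = Df yt v - Df yt (f yt *m u).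
      by rewrite mulmxBl -/v; exact: linearB.
    rewrite /psi !f_nabla_f_tensor -/v !mulmxBl.
    by apply/matrixP => i j; rewrite !mxE; ring.
  apply: (le_trans (ler_normD _ _)); rewrite [leRHS]mulr_natl mulr2n; apply: lerD.
    apply: (le_trans (psiH _ _ _)); rewrite eyt.
    have huw : `|tensor u w| <= (c * h) * (c * h).
      by apply: (le_trans (tensor_norm_le _ _)); apply: ler_pM.
    apply: (@le_trans _ _ (c * (c ^+ 3 * M * g) * ((c * h) * (c * h)))).
      apply: ler_pM => //; rewrite ?mulr_ge0 ?powR_ge0// ler_wpM2l//.
      exact: Mg.
    have -> : c * (c ^+ 3 * M * g) * ((c * h) * (c * h)) = c ^+ 6 * Z by rewrite /Z; ring.
    exact: lift.
  have e1 : `|(f y - f yt) *m u| <= c ^+ 6 * M * h ^+ 2.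
    apply: (le_trans (mulmle _ _ _ _ _ _ (fL _ _) hu)).
    rewrite distrC eyt.
    have -> : c ^+ 6 * M * h ^+ 2 = c * (c * (c ^+ 3 * M * h)) * (c * h) by ring.
    by rewrite ler_wpM2r ?mulr_ge0// !ler_wpM2l.
  apply: (@le_trans _ _ (c ^+ 9 * M * h ^+ 3)); last exact: h3M.
  apply: (le_trans (mulmle _ _ _ _ _ _ (DB _ _) hw)).
  have -> : c ^+ 9 * M * h ^+ 3 = c * (c * (c ^+ 6 * M * h ^+ 2)) * (c * h) by ring.
  by rewrite ler_wpM2r ?mulr_ge0// !ler_wpM2l.
have -> : 6 * c ^+ 10 * M * (h ^+ 2 * g) = 6 * (c ^+ 10 * Z) by rewrite /Z; ring.
have := ler_normD (A1 + A2) A3; have := ler_normD A1 A2.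
have : 0 <= c ^+ 10 * Z by rewrite mulr_ge0// exprn_ge0.
lra.
Qed.

Definition euler_step (R : realType) (d m : nat)
    (f : 'cV[R]_d -> 'M[R]_(d, m))
    (Df : 'cV[R]_d -> {linear 'cV[R]_d -> 'M[R]_(d, m)})
    (x : R -> T2 R m) (s t : R) (y : 'cV[R]_d) : 'cV[R]_d :=
  y + (f y *m lev1 (T2incr x s t) + f_nabla_f f Df y (lev2 (T2incr x s t))).

Lemma powR_theta (R : realType) (w kappa gamma : R) :
  0 < kappa -> 0 < gamma ->
  w `^ ((2 + gamma) * kappa) = (w `^ kappa) ^+ 2 * (w `^ kappa) `^ gamma.
Proof.
move=> k0 g0.
have -> : (2 + gamma) * kappa = kappa * 2 + kappa * gamma by ring.
rewrite powRD; last by rewrite gt_eqF// addr_gt0// mulr_gt0.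
by rewrite !powRrM powR_mulrn ?powR_ge0.
Qed.

Lemma powR_twice (R : realType) (w kappa : R) : w `^ (2 * kappa) = (w `^ kappa) ^+ 2.
Proof. by rewrite mulrC powRrM powR_mulrn// powR_ge0. Qed.

Lemma euler_almost_flow (R : realType) (d m : nat) (p gamma T : R)
    (f : 'cV[R]_d -> 'M[R]_(d, m))
    (Df : 'cV[R]_d -> {linear 'cV[R]_d -> 'M[R]_(d, m)})
    (omega : R -> R -> R) (x : R -> T2 R m) (c : R) :
  0 < p -> 0 < gamma -> gamma <= 1 -> superadditive T omega ->
  field_bounds gamma c f Df ->
  1 <= c -> m%:R <= c -> omega 0 T `^ p^-1 <= c ->
  omega 0 T `^ p^-1 `^ (1 - gamma) <= c ->
  (forall t, 0 <= t -> t <= T -> lev0 (x t) = 1) ->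
  (forall s t, 0 <= s -> s <= t -> t <= T ->
    `|lev1 (T2incr x s t)| <= c * omega s t `^ p^-1 /\
    `|lev2 (T2incr x s t)| <= c * (omega s t `^ p^-1) ^+ 2) ->
  almost_flow T p^-1 gamma (6 * c ^+ 10) omega (euler_step f Df x).
Proof.
move=> p0 g0 g1 sw fb c1 mc Hc Hgc x0 xb.
have [[fL _] _ _ psiH _] := fb.
have c0 : 0 <= c by lra.
have k0 : 0 < p^-1 by rewrite invr_gt0.
have w0 s t : 0 <= s -> s <= t -> t <= T -> 0 <= omega s t.
  by case: sw => + _ _; exact.
have wOm s t : 0 <= s -> s <= t -> t <= T -> omega s t <= omega 0 T.
  by move=> s0 st tT; apply: (superadditive_le sw).
have hb s t : 0 <= s -> s <= t -> t <= T ->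
    omega s t `^ p^-1 <= c /\ omega s t `^ p^-1 <= c * (omega s t `^ p^-1) `^ gamma.
  move=> s0 st tT; set h := omega s t `^ p^-1.
  have h0 : 0 <= h by exact: powR_ge0.
  have hH : h <= omega 0 T `^ p^-1.
    by apply: ler_powRl; [exact: ltW|exact: w0|exact: wOm].
  split; first exact: le_trans Hc.
  apply: (@le_trans _ _ (h `^ ((1 - gamma) + gamma))); first by rewrite subrK powRr1.
  apply: (le_trans (powR_split _ g0 h0 hH)); first by lra.
  by rewrite ler_wpM2r// powR_ge0.
have hmon s r r' t : 0 <= s -> s <= r -> r <= r' -> r' <= t -> t <= T ->
    omega r r' `^ p^-1 <= omega s t `^ p^-1.
  move=> s0 sr rr rt tT; apply: ler_powRl; first exact: ltW.
    by apply: w0 => //; [exact: le_trans sr|exact: le_trans tT].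
  exact: (superadditive_le sw).
have xb' s r r' t : 0 <= s -> s <= r -> r <= r' -> r' <= t -> t <= T ->
    `|lev1 (T2incr x r r')| <= c * omega s t `^ p^-1 /\
    `|lev2 (T2incr x r r')| <= c * (omega s t `^ p^-1) ^+ 2.
  move=> s0 sr rr rt tT.
  have [b1 b2] := xb r r' (le_trans s0 sr) rr (le_trans rt tT).
  have hm := hmon s r r' t s0 sr rr rt tT.
  split; first by apply: (le_trans b1); rewrite ler_wpM2l.
  by apply: (le_trans b2); rewrite ler_wpM2l// lerXn2r// ?nnegrE ?powR_ge0.
split.
- move=> s t y s0 st tT.
  have [b1 b2] := xb' s s t t s0 (lexx _) st (lexx _) tT.
  have [hc hg] := hb s t s0 st tT.
  have h0 : 0 <= omega s t `^ p^-1 by exact: powR_ge0.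
  have z1 : `|0 : 'cV[R]_m| <= c * omega s t `^ p^-1 by rewrite normr0 mulr_ge0.
  have z2 : `|0 : 'M[R]_m| <= c * (omega s t `^ p^-1) ^+ 2.
    by rewrite normr0 mulr_ge0// exprn_ge0.
  have [h _] := @euler_defect R d m gamma c _ f Df y _ _ _ _ g0 g1 fb c1 mc h0 hc hg b1 z1 b2 z2.
  apply: (le_trans h); rewrite !ler_wpM2r ?addr_ge0//.
  by apply: ler_pM; rewrite ?exprn_ge0 ?ler_nat// ler_weXn2l.
- move=> s r t y s0 sr rt tT.
  have [b1 b2] := xb' s s r t s0 (lexx _) sr rt tT.
  have [b3 b4] := xb' s r t t s0 sr rt (lexx _) tT.
  have st := le_trans sr rt.
  have [hc hg] := hb s t s0 st tT.
  have h0 : 0 <= omega s t `^ p^-1 by exact: powR_ge0.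
  have [_ h] := @euler_defect R d m gamma c _ f Df y _ _ _ _ g0 g1 fb c1 mc h0 hc hg b1 b3 b2 b4.
  rewrite (powR_theta _ k0 g0).
  have rT := le_trans rt tT; have r0 := le_trans s0 sr.
  have [e1 e2] := chen (x0 s s0 (le_trans st tT)) (x0 r r0 rT) (x0 t (le_trans r0 rt) tT).
  by rewrite /euler_step e1 e2.
move=> s t y y' s0 st tT; rewrite /euler_step.
have [b1 b2] := xb s t s0 st tT.
set X := lev1 _ in b1 *; set XX := lev2 _ in b2 *.
have -> : y + (f y *m X + f_nabla_f f Df y XX) - (y' + (f y' *m X + f_nabla_f f Df y' XX)) =
   (y - y') + ((f y - f y') *m X + (f_nabla_f f Df y XX - f_nabla_f f Df y' XX)).
  by rewrite mulmxBl; apply/matrixP => i j; rewrite !mxE; ring.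
apply: (le_trans (ler_normD _ _)); rewrite lerD2l.
apply: (le_trans (ler_normD _ _)); rewrite powR_twice mulrDr.
set h := omega s t `^ p^-1 in b1 b2 *.
have h0 : 0 <= h by exact: powR_ge0.
have lift k (a : R) : (k <= 10)%N -> 0 <= a -> c ^+ k * a <= 6 * c ^+ 10 * a.
  move=> k10 a0; rewrite ler_wpM2r//.
  have h1 : c ^+ k <= c ^+ 10 by exact: ler_weXn2l.
  have h2 : 0 <= c ^+ 10 by exact: exprn_ge0.
  lra.
apply: lerD.
  apply: (@le_trans _ _ (c ^+ 3 * (h * `|y - y'|))); last by rewrite lift ?mulr_ge0.
  apply: (le_trans (mulmx_norm_le _ _)).
  have -> : c ^+ 3 * (h * `|y - y'|) = c * (c * `|y - y'|) * (c * h) by ring.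
  by apply: ler_pM => //; apply: ler_pM.
apply: (@le_trans _ _ (c ^+ 2 * (h ^+ 2 * `|y - y'| `^ gamma))); last first.
  by rewrite lift ?mulr_ge0 ?powR_ge0 ?exprn_ge0.
apply: (le_trans (psiH _ _ _)).
have -> : c ^+ 2 * (h ^+ 2 * `|y - y'| `^ gamma) = c * `|y - y'| `^ gamma * (c * h ^+ 2) by ring.
by rewrite ler_wpM2l// mulr_ge0 ?powR_ge0.
Qed.

(** * The second level *)

(** To leading order [z1] is [F u] and [z2] is [F w], so the tensor z1 (x) z2
    cancels the Chen term F (u (x) w) F^T up to third order in [h]. *)
Lemma level2_defect (R : realType) (n m : nat) (b h : R)
   (z1 z2 : 'cV[R]_n) (F F' : 'M[R]_(n, m)) (u w : 'cV[R]_m) (Q : 'M[R]_m) :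
  1 <= b -> m%:R <= b -> 0 <= h ->
  `|F| <= b -> `|F'| <= b -> `|F' - F| <= b * h -> `|u| <= b * h -> `|w| <= b * h ->
  `|Q| <= b * h ^+ 2 -> `|z2| <= b * h ->
  `|z1 - F *m u| <= b * h ^+ 2 -> `|z2 - F' *m w| <= b * h ^+ 2 ->
  `|tensor z1 z2 - F *m tensor u w *m F^T + (F' *m Q *m F'^T - F *m Q *m F^T)|
     <= 6 * b ^+ 6 * h ^+ 3.
Proof.
move=> b1 mb h0 hF hF' hFF hu hw hQ hz2 he1 he2.
have b0 : 0 <= b by lra.
have eqle (r r' : R) : r = r' -> r <= r' by move=> ->.
have mulmle (k : nat) (A : 'M[R]_(k, m)) l (B : 'M[R]_(m, l)) a a' :
   `|A| <= a -> `|B| <= a' -> `|A *m B| <= b * a * a'.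
  move=> Aa Ba; apply: (le_trans (mulmx_norm_le _ _)).
  by apply: ler_pM => //; apply: ler_pM.
have trle (k l : nat) (A : 'M[R]_(k, l)) a : `|A| <= a -> `|A^T| <= a.
  exact: le_trans (trmx_norm_le _).
have tenle (u1 u2 : 'cV[R]_n) a a' : `|u1| <= a -> `|u2| <= a' -> `|tensor u1 u2| <= a * a'.
  by move=> h1 h2; apply: (le_trans (tensor_norm_le _ _)); exact: ler_pM.
pose e1 := z1 - F *m u; pose e2 := (F' - F) *m w + (z2 - F' *m w).
have he2' : `|e2| <= 2 * b ^+ 3 * h ^+ 2.
  apply: (le_trans (ler_normD _ _)).
  have h1 := mulmle _ _ _ _ _ _ hFF hw.
  have : b ^+ 1 * h ^+ 2 <= b ^+ 3 * h ^+ 2.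
    by rewrite ler_wpM2r ?exprn_ge0// ler_weXn2l.
  have : b * (b * h) * (b * h) = b ^+ 3 * h ^+ 2 by ring.
  rewrite expr1; lra.
have hp : `|F *m u| <= b ^+ 3 * h.
  by apply: (le_trans (mulmle _ _ _ _ _ _ hF hu)); apply: eqle; ring.
have -> : tensor z1 z2 - F *m tensor u w *m F^T + (F' *m Q *m F'^T - F *m Q *m F^T) =
  tensor e1 z2 + tensor (F *m u) e2 + ((F' - F) *m Q *m F'^T + F *m Q *m (F' - F)^T).
  have -> : F *m tensor u w *m F^T = tensor (F *m u) (F *m w).
    by rewrite /tensor trmx_mul !mulmxA.
  have -> : tensor e1 z2 = tensor z1 z2 - tensor (F *m u) z2 by exact: tensorB.
  have -> : tensor (F *m u) e2 = tensor (F *m u) z2 - tensor (F *m u) (F *m w).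
    rewrite /tensor -mulmxBr -linearB /=; congr (_ *m _^T).
    by rewrite /e2 mulmxBl; apply/matrixP => i j; rewrite !mxE; ring.
  have -> : (F' - F) *m Q *m F'^T = F' *m Q *m F'^T - F *m Q *m F'^T.
    by rewrite !mulmxBl.
  have -> : F *m Q *m (F' - F)^T = F *m Q *m F'^T - F *m Q *m F^T.
    by rewrite linearB /= mulmxBr.
  by apply/matrixP => i j; rewrite !mxE; ring.
have t1 : `|tensor e1 z2| <= b ^+ 2 * h ^+ 3.
  by apply: (le_trans (tenle _ _ _ _ he1 hz2)); apply: eqle; ring.
have t2 : `|tensor (F *m u) e2| <= 2 * (b ^+ 6 * h ^+ 3).
  by apply: (le_trans (tenle _ _ _ _ hp he2')); apply: eqle; ring.
have t3 : `|(F' - F) *m Q *m F'^T| <= b ^+ 5 * h ^+ 3.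
  apply: (le_trans (mulmle _ _ _ _ _ _ (mulmle _ _ _ _ _ _ hFF hQ) (trle _ _ _ _ hF'))).
  by apply: eqle; ring.
have t4 : `|F *m Q *m (F' - F)^T| <= b ^+ 5 * h ^+ 3.
  apply: (le_trans (mulmle _ _ _ _ _ _ (mulmle _ _ _ _ _ _ hF hQ) (trle _ _ _ _ hFF))).
  by apply: eqle; ring.
have lift k : (k <= 6)%N -> b ^+ k * h ^+ 3 <= b ^+ 6 * h ^+ 3.
  by move=> k6; rewrite ler_wpM2r ?exprn_ge0// ler_weXn2l.
have : 0 <= b ^+ 6 * h ^+ 3 by rewrite mulr_ge0// exprn_ge0.
have := lift 2 isT; have := lift 5 isT.
have := ler_normD (tensor e1 z2 + tensor (F *m u) e2)
  ((F' - F) *m Q *m F'^T + F *m Q *m (F' - F)^T).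
have := ler_normD (tensor e1 z2) (tensor (F *m u) e2).
have := ler_normD ((F' - F) *m Q *m F'^T) (F *m Q *m (F' - F)^T).
lra.
Qed.

(** The integral of z against dz, where z is controlled by X1 with derivative
    F.  As mu_(s,t) is a translation, its third condition is trivial, and the
    second says that the germ z_s (x) (z_t - z_s) + F_s X2 F_s^T is additive
    up to omega^theta. *)
Lemma level2_lift (R : realType) (n m : nat) (T kappa gamma b : R) (omega : R -> R -> R)
    (z : R -> 'cV[R]_n) (F : R -> 'M[R]_(n, m))
    (X1 : R -> R -> 'cV[R]_m) (X2 : R -> R -> 'M[R]_m) :
  0 <= T -> 0 < kappa -> 0 < gamma -> gamma <= 1 -> 1 < (2 + gamma) * kappa ->
  superadditive T omega -> 1 <= b -> m%:R <= b ->
  omega 0 T `^ kappa <= b -> omega 0 T `^ kappa `^ (1 - gamma) <= b ->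
  (forall s r t, 0 <= s -> s <= r -> r <= t -> t <= T ->
     X2 s t = X2 s r + X2 r t + tensor (X1 s r) (X1 r t)) ->
  (forall t, 0 <= t -> t <= T -> `|z t| <= b /\ `|F t| <= b) ->
  (forall s t, 0 <= s -> s <= t -> t <= T -> let h := omega s t `^ kappa in
    [/\ `|X1 s t| <= b * h, `|X2 s t| <= b * h ^+ 2,
        `|F t - F s| <= b * h, `|z t - z s| <= b * h &
        `|z t - z s - F s *m X1 s t| <= b * h ^+ 2]) ->
  exists (Z : R -> 'M[R]_n) (K : R), forall s t, 0 <= s -> s <= t -> t <= T ->
    `|Z t - (Z s + (tensor (z s) (z t - z s) + F s *m X2 s t *m (F s)^T))|
      <= K * omega s t `^ ((2 + gamma) * kappa).
Proof.
move=> T0 k0 g0 g1 th1 sw b1 mb Hb Hgb X2D zF bd.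
have b0 : 0 <= b by lra.
pose A s t := tensor (z s) (z t - z s) + F s *m X2 s t *m (F s)^T.
pose mu s t (Z : 'M[R]_n) := Z + A s t.
have w0 s t : 0 <= s -> s <= t -> t <= T -> 0 <= omega s t.
  by case: sw => + _ _; exact.
have hle s t : 0 <= s -> s <= t -> t <= T -> omega s t `^ kappa <= omega 0 T `^ kappa.
  move=> s0 st tT; apply: ler_powRl; [exact: ltW|exact: w0|].
  exact: (superadditive_le sw).
have af : almost_flow T kappa gamma (6 * b ^+ 7) omega mu.
  split.
  - move=> s t Z s0 st tT; rewrite /mu addrC addKr.
    have [x1 x2 _ z1 _] := bd s t s0 st tT.
    have [zs Fs] := zF s s0 (le_trans st tT).
    set h := omega s t `^ kappa in x1 x2 z1 *.
    have h0 : 0 <= h by exact: powR_ge0.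
    have hb : h <= b by exact: le_trans (hle _ _ s0 st tT) Hb.
    apply: (@le_trans _ _ (6 * b ^+ 7 * 1 * h)); last first.
      rewrite ler_wpM2r// ler_wpM2l ?mulr_ge0 ?exprn_ge0//.
      by rewrite lerDl.
    have a1 : `|tensor (z s) (z t - z s)| <= b * (b * h).
      by apply: (le_trans (tensor_norm_le _ _)); exact: ler_pM.
    have a2 : `|F s *m X2 s t *m (F s)^T| <= b * (b * b * (b * h ^+ 2)) * b.
      apply: (le_trans (mulmx_norm_le _ _)); apply: ler_pM; rewrite ?mulr_ge0//; last first.
        exact: le_trans (trmx_norm_le _) Fs.
      apply: ler_pM => //; apply: (le_trans (mulmx_norm_le _ _)).
      by apply: ler_pM => //; apply: ler_pM.
    have a3 : b * (b * b * (b * h ^+ 2)) * b <= b ^+ 6 * h.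
      have -> : b * (b * b * (b * h ^+ 2)) * b = b ^+ 5 * h * h by ring.
      have -> : b ^+ 6 * h = b ^+ 5 * h * b by ring.
      by rewrite ler_wpM2l// mulr_ge0// exprn_ge0.
    have l2 : b ^+ 2 * h <= b ^+ 7 * h by rewrite ler_wpM2r// ler_weXn2l.
    have l6 : b ^+ 6 * h <= b ^+ 7 * h by rewrite ler_wpM2r// ler_weXn2l.
    have l7 : 0 <= b ^+ 7 * h by rewrite mulr_ge0// exprn_ge0.
    apply: (le_trans (ler_normD _ _)).
    have e2 : b * (b * h) = b ^+ 2 * h by ring.
    rewrite mulr1 -mulrA; lra.
  - move=> s r t Z s0 sr rt tT; have st := le_trans sr rt.
    have rT := le_trans rt tT; have r0 := le_trans s0 sr.
    have [x1 x2 f1 z1 e1] := bd s r s0 sr rT.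
    have [x3 x4 f3 z3 e3] := bd r t r0 rt tT.
    have hsr : omega s r `^ kappa <= omega s t `^ kappa.
      by apply: ler_powRl; [exact: ltW|exact: w0|exact: (superadditive_le sw)].
    have hrt : omega r t `^ kappa <= omega s t `^ kappa.
      by apply: ler_powRl; [exact: ltW|exact: w0|exact: (superadditive_le sw)].
    have up (q q' a : R) : q <= q' -> a <= b * q -> a <= b * q'.
      by move=> qq; move=> /le_trans; apply; rewrite ler_wpM2l.
    have sq (q q' : R) : 0 <= q -> q <= q' -> q ^+ 2 <= q' ^+ 2.
      by move=> q0 qq; rewrite lerXn2r// nnegrE// (le_trans q0).
    have hsr2 := sq _ _ (powR_ge0 _ _) hsr; have hrt2 := sq _ _ (powR_ge0 _ _) hrt.
    have h0 : 0 <= omega s t `^ kappa by exact: powR_ge0.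
    have [_ Fs] := zF s s0 (le_trans sr rT).
    have [_ Fr] := zF r r0 rT.
    have := level2_defect b1 mb h0 Fs Fr (up _ _ _ hsr f1) (up _ _ _ hsr x1)
       (up _ _ _ hrt x3) (up _ _ _ hrt2 x4) (up _ _ _ hrt z3) (up _ _ _ hsr2 e1)
       (up _ _ _ hrt2 e3).
    have -> : mu r t (mu s r Z) - mu s t Z =
      tensor (z r - z s) (z t - z r) - F s *m tensor (X1 s r) (X1 r t) *m (F s)^T
        + (F r *m X2 r t *m (F r)^T - F s *m X2 r t *m (F s)^T).
      rewrite /mu /A (X2D s r t)// !mulmxDr !mulmxDl tensorB.
      have -> : z t - z s = (z r - z s) + (z t - z r).
        by apply/matrixP => i j; rewrite !mxE; ring.
      rewrite (tensorDr (z s) (z r - z s)).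
      by apply/matrixP => i j; rewrite !mxE; ring.
    move=> /le_trans; apply.
    rewrite (powR_theta _ k0 g0).
    set h := omega s t `^ kappa in h0 *.
    have hg : h <= b * h `^ gamma.
      apply: (@le_trans _ _ (h `^ ((1 - gamma) + gamma))); first by rewrite subrK powRr1.
      apply: (le_trans (powR_split _ g0 h0 (hle _ _ s0 st tT))); first by lra.
      by rewrite ler_wpM2r// powR_ge0.
    apply: (@le_trans _ _ (6 * b ^+ 7 * 1 * (h ^+ 2 * h `^ gamma))); last first.
      rewrite ler_wpM2r ?mulr_ge0 ?powR_ge0 ?exprn_ge0//.
      by rewrite ler_wpM2l ?lerDl// mulr_ge0// exprn_ge0.
    have -> : 6 * b ^+ 6 * h ^+ 3 = 6 * b ^+ 6 * h ^+ 2 * h by ring.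
    have -> : 6 * b ^+ 7 * 1 * (h ^+ 2 * h `^ gamma) =
      6 * b ^+ 6 * h ^+ 2 * (b * h `^ gamma) by ring.
    by rewrite ler_wpM2l// !mulr_ge0// ?exprn_ge0.
  - move=> s t Z Z' s0 st tT.
    have -> : mu s t Z - mu s t Z' = Z - Z' by rewrite /mu opprD addrACA subrr addr0.
    rewrite lerDl mulr_ge0 ?addr_ge0 ?mulr_ge0 ?powR_ge0 ?exprn_ge0//.
have C0 : 0 <= 6 * b ^+ 7 by rewrite mulr_ge0// exprn_ge0.
have [Z [K [_ [_ _ ZK]]]] := almost_flow_solution 0 (@compact_mx_ball R n n)
  T0 k0 g0 g1 th1 C0 sw af.
by exists Z, K.
Qed.

(** * Solutions *)

Lemma col_mx_norm_le (R : realType) (m d k : nat) (A : 'M[R]_(m, k)) (B : 'M[R]_(d, k)) c :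
  `|A| <= c -> `|B| <= c -> `|col_mx A B| <= c.
Proof.
move=> Ac Bc; apply: mx_norm_le => [|i j]; first exact: le_trans Ac.
case: (split_ordP i) => i' ->; rewrite ?col_mxEu ?col_mxEd.
  exact: le_trans (mx_entry_le _ _ _) Ac.
exact: le_trans (mx_entry_le _ _ _) Bc.
Qed.

Lemma block_mx0_norm_le (R : realType) (m d : nat) (A : 'M[R]_m) (B : 'M[R]_(m, d))
    (C : 'M[R]_(d, m)) (D : 'M[R]_d) :
  `|block_mx 0 B C D| <= `|block_mx A B C D|.
Proof.
apply: mx_norm_le => // i j.
case: (split_ordP i) => i' ->; case: (split_ordP j) => j' ->.
- by rewrite block_mxEul mxE normr0.
- by apply: le_trans (mx_entry_le _ (lshift d i') (rshift m j')); rewrite !block_mxEur.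
- by apply: le_trans (mx_entry_le _ (rshift m i') (lshift d j')); rewrite !block_mxEdl.
- by apply: le_trans (mx_entry_le _ (rshift m i') (rshift m j')); rewrite !block_mxEdr.
Qed.

Lemma tensor_col_mx (R : realType) (m d : nat) (u u' : 'cV[R]_m) (v v' : 'cV[R]_d) :
  tensor (col_mx u v) (col_mx u' v') =
  block_mx (tensor u u') (tensor u v') (tensor v u') (tensor v v').
Proof. by rewrite /tensor tr_col_mx mul_col_row. Qed.

(** The four blocks are the leading terms that a solution must have on
    U (x) U, U (x) V, V (x) U and V (x) V. *)
Lemma graph_conj (R : realType) (m d : nat) (G : 'M[R]_(d, m)) (X : 'M[R]_m) :
  col_mx 1%:M G *m X *m (col_mx 1%:M G)^T =
  block_mx X (X *m G^T) (G *m X) (G *m X *m G^T).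
Proof. by rewrite mul_col_mx mul1mx tr_col_mx trmx1 mul_col_row !mulmx1. Qed.

(** The path [Z] given by level2_lift need not have exactly the second level
    of x as its U (x) U block.  Overwriting this block is harmless: [X] being
    the second level of the increment of x, the residual vanishes there
    afterwards, and the other blocks of the residual are untouched. *)
Lemma residual_norm_le (R : realType) (m d : nat) (Z1 Z2 : 'M[R]_(m + d))
    (L1 L2 X : 'M[R]_m) (u1 u2 : 'cV[R]_m) (y1 y2 : 'cV[R]_d) (G : 'M[R]_(d, m)) :
  X = L2 - L1 - tensor u1 (u2 - u1) ->
  `|block_mx L2 (ursubmx Z2) (dlsubmx Z2) (drsubmx Z2)
      - block_mx L1 (ursubmx Z1) (dlsubmx Z1) (drsubmx Z1)
      - tensor (col_mx u1 y1) (col_mx u2 y2 - col_mx u1 y1)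
      - block_mx X (X *m G^T) (G *m X) (G *m X *m G^T)|
  <= `|Z2 - (Z1 + (tensor (col_mx u1 y1) (col_mx u2 y2 - col_mx u1 y1)
      + block_mx X (X *m G^T) (G *m X) (G *m X *m G^T)))|.
Proof.
move=> XE; rewrite opprD addrA opprD addrA.
rewrite -[in leRHS](submxK Z1) -[in leRHS](submxK Z2).
have -> : col_mx u2 y2 - col_mx u1 y1 = col_mx (u2 - u1) (y2 - y1).
  by rewrite opp_col_mx add_col_mx.
rewrite tensor_col_mx !opp_block_mx !add_block_mx -XE subrr.
exact: block_mx0_norm_le.
Qed.

Lemma rde_of_first_level (R : realType) (d m : nat) (p gamma T c K B : R)
    (f : 'cV[R]_d -> 'M[R]_(d, m))
    (Df : 'cV[R]_d -> {linear 'cV[R]_d -> 'M[R]_(d, m)})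
    (a : 'cV[R]_d) (omega : R -> R -> R) (x : R -> T2 R m) (y : R -> 'cV[R]_d) :
  0 <= T -> 0 < p -> 0 < gamma -> gamma <= 1 -> 1 < (2 + gamma) * p^-1 ->
  superadditive T omega -> field_bounds gamma c f Df ->
  1 <= c -> m%:R <= c -> omega 0 T `^ p^-1 <= c ->
  omega 0 T `^ p^-1 `^ (1 - gamma) <= c ->
  (forall t, 0 <= t -> t <= T -> lev0 (x t) = 1) ->
  (forall s t, 0 <= s -> s <= t -> t <= T ->
    `|lev1 (T2incr x s t)| <= c * omega s t `^ p^-1 /\
    `|lev2 (T2incr x s t)| <= c * (omega s t `^ p^-1) ^+ 2) ->
  y 0 = a -> (forall t, `|y t| <= B) ->
  (forall s t, 0 <= s -> s <= t -> t <= T ->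
    `|y t - euler_step f Df x s t (y s)| <= K * omega s t `^ ((2 + gamma) * p^-1)) ->
  exists Y : R -> T2 R (m + d), rde_solution p T omega f Df a x Y.
Proof.
move=> T0 p0 g0 g1 th1 sw [[fL fB] _ _ _ psiB] c1 mc Hc Hgc x0 xb ya yB yK.
have c0 : 0 <= c by lra.
have k0 : 0 < p^-1 by rewrite invr_gt0.
have B0 : 0 <= B by exact: le_trans (yB 0).
have hc s t : 0 <= s -> s <= t -> t <= T -> omega s t `^ p^-1 <= c.
  move=> s0 st tT; apply: le_trans Hc; apply: ler_powRl; [exact: ltW|by case: sw => + _ _; exact|].
  exact: (superadditive_le sw).
have thle s t k : 0 <= s -> s <= t -> t <= T ->
    k * omega s t `^ ((2 + gamma) * p^-1) <= 2 * `|k| * c * (omega s t `^ p^-1) ^+ 2.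
  move=> s0 st tT; rewrite (powR_theta _ k0 g0).
  set h := omega s t `^ p^-1; have h0 : 0 <= h by exact: powR_ge0.
  have hg : h `^ gamma <= 2 * c.
    apply: (le_trans (powR_le1D h0 (ltW g0) g1)).
    have := hc s t s0 st tT; rewrite -/h; lra.
  apply: (@le_trans _ _ (`|k| * (h ^+ 2 * h `^ gamma))).
    by rewrite ler_wpM2r ?ler_norm// mulr_ge0 ?powR_ge0 ?exprn_ge0.
  have -> : 2 * `|k| * c * h ^+ 2 = `|k| * (h ^+ 2 * (2 * c)) by ring.
  by rewrite !ler_wpM2l ?exprn_ge0.
pose M := 1 + B; have M1 : 1 <= M by rewrite /M; lra.
have M0 : 0 <= M by lra.
have yM t : 1 + `|y t| <= M by rewrite lerD2l.
have fM t : `|f (y t)| <= c * M by apply: (le_trans (fB _)); rewrite ler_wpM2l.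
(* b1 and b2 control the remainder and the increments of y. *)
pose b1 := 2 * `|K| * c + c ^+ 2 * M.
have b10 : 0 <= b1 by rewrite addr_ge0// !mulr_ge0// exprn_ge0.
pose b2 := b1 * c + c ^+ 3 * M.
have b20 : 0 <= b2 by rewrite addr_ge0// !mulr_ge0// exprn_ge0.
have y1 s t : 0 <= s -> s <= t -> t <= T ->
    `|y t - y s - f (y s) *m lev1 (T2incr x s t)| <= b1 * (omega s t `^ p^-1) ^+ 2.
  move=> s0 st tT; have [_ x2] := xb s t s0 st tT.
  have -> : y t - y s - f (y s) *m lev1 (T2incr x s t) =
     (y t - euler_step f Df x s t (y s)) + f_nabla_f f Df (y s) (lev2 (T2incr x s t)).
    by rewrite /euler_step; apply/matrixP => i j; rewrite !mxE; ring.
  apply: (le_trans (ler_normD _ _)); rewrite mulrDl; apply: lerD.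
    exact: le_trans (yK _ _ s0 st tT) (thle _ _ _ s0 st tT).
  apply: (le_trans (psiB _ _)).
  have -> : c ^+ 2 * M * (omega s t `^ p^-1) ^+ 2 = c * M * (c * (omega s t `^ p^-1) ^+ 2) by ring.
  by apply: ler_pM => //; [rewrite mulr_ge0// addr_ge0|rewrite ler_wpM2l].
have y2 s t : 0 <= s -> s <= t -> t <= T -> `|y t - y s| <= b2 * omega s t `^ p^-1.
  move=> s0 st tT; have [x1 _] := xb s t s0 st tT.
  rewrite -(subrK (f (y s) *m lev1 (T2incr x s t)) (y t - y s)).
  apply: (le_trans (ler_normD _ _)); rewrite mulrDl; apply: lerD.
    apply: (le_trans (y1 s t s0 st tT)); set h := omega s t `^ p^-1.
    have -> : b1 * h ^+ 2 = b1 * h * h by ring.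
    have -> : b1 * c * h = b1 * h * c by ring.
    by rewrite ler_wpM2l ?mulr_ge0 ?powR_ge0//; exact: hc.
  apply: (le_trans (mulmx_norm_le _ _)).
  have -> : c ^+ 3 * M * omega s t `^ p^-1 = c * (c * M) * (c * omega s t `^ p^-1) by ring.
  by apply: ler_pM => //; apply: ler_pM.
pose z t := col_mx (lev1 (x t)) (y t).
pose F t : 'M[R]_(m + d, m) := col_mx 1%:M (f (y t)).
pose b := c + b1 + b2 + c * b2 + (1 + c * M) + (`|lev1 (x 0)| + c * c) + B.
have cb2 : 0 <= c * b2 by rewrite mulr_ge0.
have cM : 0 <= c * M by rewrite mulr_ge0.
have cc : 0 <= c * c by rewrite mulr_ge0.
have lx0 : 0 <= `|lev1 (x 0)| by [].
have cb : c <= b by rewrite /b; lra.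
have incr1 s t : 0 <= s -> s <= t -> t <= T -> lev1 (T2incr x s t) = lev1 (x t) - lev1 (x s).
  by move=> s0 st tT; rewrite T2incr_lev1 ?x0// ?(le_trans s0)// (le_trans st).
have zD s t : 0 <= s -> s <= t -> t <= T ->
    z t - z s = col_mx (lev1 (T2incr x s t)) (y t - y s).
  by move=> s0 st tT; rewrite /z opp_col_mx add_col_mx incr1.
have zF t : 0 <= t -> t <= T -> `|z t| <= b /\ `|F t| <= b.
  move=> t0 tT; split; apply: col_mx_norm_le.
  - have [e _] := xb 0 t (lexx _) t0 tT.
    have -> : lev1 (x t) = lev1 (T2incr x 0 t) + lev1 (x 0) by rewrite incr1// subrK.
    apply: (le_trans (ler_normD _ _)).
    have : c * omega 0 t `^ p^-1 <= c * c by rewrite ler_wpM2l// hc.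
    rewrite /b; lra.
  - by apply: (le_trans (yB t)); rewrite /b; lra.
  - apply: mx_norm_le => [|i j]; first by rewrite (le_trans c0).
    rewrite mxE; case: (_ == _); rewrite ?normr1 ?normr0; rewrite /b; lra.
  - by apply: (le_trans (fM t)); rewrite /b; lra.
have X2D s r t : 0 <= s -> s <= r -> r <= t -> t <= T ->
    lev2 (T2incr x s t) = lev2 (T2incr x s r) + lev2 (T2incr x r t)
      + tensor (lev1 (T2incr x s r)) (lev1 (T2incr x r t)).
  move=> s0 sr rt tT; have rT := le_trans rt tT; have r0 := le_trans s0 sr.
  by have [] := chen (x0 s s0 (le_trans sr rT)) (x0 r r0 rT) (x0 t (le_trans r0 rt) tT).
have bd s t : 0 <= s -> s <= t -> t <= T -> let h := omega s t `^ p^-1 in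
    [/\ `|lev1 (T2incr x s t)| <= b * h, `|lev2 (T2incr x s t)| <= b * h ^+ 2,
        `|F t - F s| <= b * h, `|z t - z s| <= b * h &
        `|z t - z s - F s *m lev1 (T2incr x s t)| <= b * h ^+ 2].
  move=> s0 st tT h; have h0 : 0 <= h by exact: powR_ge0.
  have h20 : 0 <= h ^+ 2 by exact: exprn_ge0.
  have up (q a' : R) : 0 <= q -> a' <= b -> a' * q <= b * q by move=> *; rewrite ler_wpM2r.
  have [x1 x2] := xb s t s0 st tT; have yy := y2 s t s0 st tT; have yyy := y1 s t s0 st tT.
  rewrite -/h in x1 x2 yy yyy.
  have x1' : `|lev1 (T2incr x s t)| <= b * h by apply: (le_trans x1); exact: up.
  have bh : 0 <= b * h by exact: le_trans x1'.
  have bh2 : 0 <= b * h ^+ 2 by rewrite mulr_ge0// (le_trans c0).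
  split=> //.
  - by apply: (le_trans x2); exact: up.
  - rewrite /F opp_col_mx add_col_mx subrr; apply: col_mx_norm_le; first by rewrite normr0.
    apply: (le_trans (fL _ _)); apply: (@le_trans _ _ (c * b2 * h)).
      by rewrite -mulrA ler_wpM2l.
    by apply: up => //; rewrite /b; lra.
  - rewrite zD//; apply: col_mx_norm_le => //.
    by apply: (le_trans yy); apply: up => //; rewrite /b; lra.
  - rewrite zD// /F mul_col_mx mul1mx opp_col_mx add_col_mx subrr.
    apply: col_mx_norm_le; first by rewrite normr0.
    by apply: (le_trans yyy); apply: up => //; rewrite /b; lra.
have [Z [K2 ZK]] := level2_lift T0 k0 g0 g1 th1 sw (le_trans c1 cb) (le_trans mc cb)
  (le_trans Hc cb) (le_trans Hgc cb) X2D zF bd.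
pose Y t : T2 R (m + d) := MkT2 1 (z t)
  (block_mx (lev2 (x t)) (ursubmx (Z t)) (dlsubmx (Z t)) (drsubmx (Z t))).
have Y1 s t : lev1 (T2incr Y s t) = z t - z s by rewrite T2incr_lev1.
pose V s t := block_mx (lev2 (T2incr x s t)) (lev2 (T2incr x s t) *m (f (y s))^T)
      (f (y s) *m lev2 (T2incr x s t)) (f (y s) *m lev2 (T2incr x s t) *m (f (y s))^T).
have Y2 s t : 0 <= s -> s <= t -> t <= T ->
    `|lev2 (T2incr Y s t) - V s t| <= K2 * omega s t `^ ((2 + gamma) * p^-1).
  move=> s0 st tT; rewrite T2incr_lev2//=.
  have := ZK s t s0 st tT; rewrite /F graph_conj => /(le_trans _); apply.
  apply: residual_norm_le.
  by rewrite T2incr_lev2 ?x0// ?(le_trans s0)// (le_trans st).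
exists Y; split.
- split=> //.
  exists (b + (2 * `|K2| * c + b ^+ 5)) => s t s0 st tT.
  rewrite div1r powR_twice; set h := omega s t `^ p^-1.
  have h0 : 0 <= h by exact: powR_ge0.
  have h20 : 0 <= h ^+ 2 by exact: exprn_ge0.
  have b0 : 0 <= b by exact: le_trans cb.
  have b50 : 0 <= b ^+ 5 by exact: exprn_ge0.
  have kc0 : 0 <= 2 * `|K2| * c by rewrite !mulr_ge0.
  have [_ x2 _ zz _] := bd s t s0 st tT.
  split.
    by rewrite Y1; apply: (le_trans zz); rewrite ler_wpM2r// lerDl addr_ge0.
  have hV : `|V s t| <= b ^+ 5 * h ^+ 2.
    have [_ Fs] := zF s s0 (le_trans st tT).
    rewrite /V -graph_conj -/(F s).
    have -> : b ^+ 5 * h ^+ 2 = b * (b * b * (b * h ^+ 2)) * b by ring.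
    have mb := le_trans mc cb.
    apply: (le_trans (mulmx_norm_le _ _)); apply: ler_pM; rewrite ?mulr_ge0//; last first.
      exact: le_trans (trmx_norm_le _) Fs.
    apply: ler_pM => //; apply: (le_trans (mulmx_norm_le _ _)).
    by apply: ler_pM => //; apply: ler_pM.
  rewrite -(subrK (V s t) (lev2 _)); apply: (le_trans (ler_normD _ _)).
  have -> : (b + (2 * `|K2| * c + b ^+ 5)) * h ^+ 2 =
    b * h ^+ 2 + (2 * `|K2| * c * h ^+ 2 + b ^+ 5 * h ^+ 2) by ring.
  apply: (@le_trans _ _ (2 * `|K2| * c * h ^+ 2 + b ^+ 5 * h ^+ 2)).
    apply: lerD => //.
    exact: le_trans (Y2 s t s0 st tT) (thle _ _ _ s0 st tT).
  by rewrite lerDr mulr_ge0.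
- move=> t t0 tT; rewrite /T2projU /= /z col_mxKu block_mxKul -(x0 t t0 tT).
  by case: (x t).
- by rewrite /Y /z /= col_mxKd.
exists ((2 + gamma) * p^-1), (`|K| + `|K2|); split=> // s t s0 st tT.
cbv zeta; have -> : dsubmx (lev1 (Y s)) = y s by rewrite /= /z col_mxKd.
have w0 : 0 <= omega s t `^ ((2 + gamma) * p^-1) by exact: powR_ge0.
have kk : `|K| <= `|K| + `|K2| by rewrite lerDl.
have kk2 : `|K2| <= `|K| + `|K2| by rewrite lerDr.
have err2 (k l : nat) (A : 'M[R]_(k, l)) : `|A| <= `|lev2 (T2incr Y s t) - V s t| ->
    `|A| <= (`|K| + `|K2|) * omega s t `^ ((2 + gamma) * p^-1).
  move=> /le_trans; apply; apply: (le_trans (Y2 s t s0 st tT)).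
  by rewrite ler_wpM2r// (le_trans (ler_norm K2)).
have drB (A A' : 'M[R]_(m + d)) : drsubmx (A - A') = drsubmx A - drsubmx A'.
  by apply/matrixP => i j; rewrite !mxE.
have dlB (A A' : 'M[R]_(m + d)) : dlsubmx (A - A') = dlsubmx A - dlsubmx A'.
  by apply/matrixP => i j; rewrite !mxE.
have urB (A A' : 'M[R]_(m + d)) : ursubmx (A - A') = ursubmx A - ursubmx A'.
  by apply/matrixP => i j; rewrite !mxE.
have sub_norm (k l : nat) (A : 'M[R]_(k, l)) (B' : 'M[R]_(m + d)) (g1' : 'I_k -> 'I_(m + d)) g2' :
    (forall i j, A i j = B' (g1' i) (g2' j)) -> `|A| <= `|B'|.
  by move=> AB; apply: mx_norm_sub => i j; exists (g1' i), (g2' j).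
split.
- rewrite Y1 /z linearB /= !col_mxKd.
  have -> : y t - y s - (f (y s) *m lev1 (T2incr x s t)
      + f_nabla_f f Df (y s) (lev2 (T2incr x s t)))
    = y t - euler_step f Df x s t (y s) by rewrite /euler_step [in RHS]opprD [in RHS]addrA.
  apply: (le_trans (yK s t s0 st tT)).
  by rewrite ler_wpM2r// (le_trans (ler_norm K)).
- have -> : drsubmx (lev2 (T2incr Y s t)) - f (y s) *m lev2 (T2incr x s t) *m (f (y s))^T =
     drsubmx (lev2 (T2incr Y s t) - V s t) by rewrite drB /V block_mxKdr.
  by apply: err2; apply: sub_norm => i j; rewrite !mxE.
- have -> : dlsubmx (lev2 (T2incr Y s t)) - f (y s) *m lev2 (T2incr x s t) =
     dlsubmx (lev2 (T2incr Y s t) - V s t) by rewrite dlB /V block_mxKdl.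
  by apply: err2; apply: sub_norm => i j; rewrite !mxE.
- have -> : ursubmx (lev2 (T2incr Y s t)) - lev2 (T2incr x s t) *m (f (y s))^T =
     ursubmx (lev2 (T2incr Y s t) - V s t) by rewrite urB /V block_mxKur.
  by apply: err2; apply: sub_norm => i j; rewrite !mxE.
Qed.

Theorem proposition15 (R : realType) (d m : nat) (p gamma T : R)
    (hd : (1 <= d)%N) (hm : (1 <= m)%N)
    (hp2 : 2 <= p) (hp3 : p < 3)
    (hgamma0 : 0 < gamma) (hgamma1 : gamma <= 1) (hpgamma : p < 2 + gamma)
    (hT : 0 <= T)
    (f : 'cV[R]_d -> 'M[R]_(d, m))
    (Df : 'cV[R]_d -> {linear 'cV[R]_d -> 'M[R]_(d, m)})
    (hf : lip1 gamma f Df)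
    (hff : op_holder gamma
      (fun v : 'cV[R]_d => f_nabla_f f Df v : {linear 'M[R]_m -> 'cV[R]_d}))
    (a : 'cV[R]_d) (omega : R -> R -> R) (homega : control T omega)
    (x : R -> T2 R m) (hx : rough_path p T omega x) :
  exists y : R -> T2 R (m + d), rde_solution p T omega f Df a x y.
Proof.
have sw : superadditive T omega by case: homega => _ w0 wD wii; split.
have p0 : 0 < p by lra.
have k0 : 0 < p^-1 by rewrite invr_gt0.
have th1 : 1 < (2 + gamma) * p^-1 by rewrite ltr_pdivlMr// mul1r.
have [c0 fb] := lip1_field_bounds hgamma0 hgamma1 hf hff.
have [x0 [Cx xb]] := hx.
pose H := omega 0 T `^ p^-1; pose Hg := H `^ (1 - gamma).
pose c := `|c0| + 1 + m%:R + `|Cx| + H + Hg.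
have H0 : 0 <= H by exact: powR_ge0.
have Hg0 : 0 <= Hg by exact: powR_ge0.
have m0 : 0 <= m%:R :> R by [].
have n1 := normr_ge0 c0; have n2 := normr_ge0 Cx; have n3 := ler_norm c0; have n4 := ler_norm Cx.
have fbc : field_bounds gamma c f Df by apply: fb; rewrite /c; lra.
have c1 : 1 <= c by rewrite /c; lra.
have mc : m%:R <= c by rewrite /c; lra.
have Hc : omega 0 T `^ p^-1 <= c by rewrite -/H /c; lra.
have Hgc : omega 0 T `^ p^-1 `^ (1 - gamma) <= c by rewrite -/H -/Hg /c; lra.
have xbc s t : 0 <= s -> s <= t -> t <= T ->
    `|lev1 (T2incr x s t)| <= c * omega s t `^ p^-1 /\
    `|lev2 (T2incr x s t)| <= c * (omega s t `^ p^-1) ^+ 2.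
  move=> s0 st tT; have [] := xb s t s0 st tT; rewrite div1r powR_twice => e1 e2.
  have Cc : Cx <= c by rewrite /c; lra.
  split; [apply: (le_trans e1)|apply: (le_trans e2)].
    by rewrite ler_wpM2r ?powR_ge0.
  by rewrite ler_wpM2r// exprn_ge0// powR_ge0.
have af := euler_almost_flow p0 hgamma0 hgamma1 sw fbc c1 mc Hc Hgc x0 xbc.
have C0 : 0 <= 6 * c ^+ 10 by rewrite mulr_ge0// exprn_ge0//; lra.
have [y [K [B [ya yB yK]]]] := almost_flow_solution a (@compact_mx_ball R d 1) hT k0
  hgamma0 hgamma1 th1 C0 sw af.
exact: (rde_of_first_level hT p0 hgamma0 hgamma1 th1 sw fbc c1 mc Hc Hgc x0 xbc ya yB yK).
Qed.
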